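(* Let $\chi$ be a differentiable vector field on $M$, with $\chi$ and its differential $d\chi$ bounded. Then $\chi$ has a sequence of decompositions $\chi = a^n q + (\chi - a^n q)$, with $a^n$, $n\ge 1$, scalar fields on $\Lambda$, such that: (1) the sequence of vector fields $\{v^n\}_{n\ge 0}$ that satisfies $$v^{n+1} = d\varphi\, v^n + (\chi - a^{n+1} q),\qquad n = 0,1,2,\dots,$$ with $v^0$ being any bounded vector field that is differentiable on the unstable manifold, converges uniformly on $\Lambda$; here the sequence of scalar fields $\{a^n\}$ is chosen to orthogonalize $v^n$ to the unstable manifold, that is, $v^n_x\cdot q_x = 0$ for all $x\in\Lambda$ and all $n\ge 1$; (2) the sequence $\{a^n\}$ is differentiable on the unstable manifold (each $a^n$ is) and converges uniformly on $\Lambda$; and (3) the sequence of unstable derivatives $\{b^n := \partial_\xi a^n\}$ converges uniformly on $\Lambda$.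
   Context: Setting. $\varphi: M\to M$ is a $C^3$ diffeomorphism of a Riemannian manifold $M\subset\mathbb{R}^m$, whose tangent spaces $T_xM$ are all identified with $\mathbb{R}^m$ (Euclidean inner product $\cdot$ and norm $\|\cdot\|$). $\Lambda\subset M$ is a compact $\varphi$-invariant uniformly hyperbolic attractor (so unstable manifolds of its points lie in $\Lambda$): there are constants $C>0$, $\lambda\in(0,1)$ such that at each point $x\in\Lambda$, $T_xM = E^u_x\oplus E^s_x$ with $d\varphi_x E^u_x = E^u_{\varphi x}$, $d\varphi_x E^s_x = E^s_{\varphi x}$; $E^u_x$ is 1-dimensional and consists of all $v$ with $\|d\varphi^{n}_x v\|\le C\lambda^{|n|}\|v\|$ for all integers $n\le 0$; $E^s_x$ is $(m-1)$-dimensional and consists of all $v$ with $\|d\varphi^n_x v\|\le C\lambda^n\|v\|$ for all integers $n\ge 0$. $q$ is the unit vector field with $q_x\in E^u_x$ (tangent to the one-dimensional unstable manifold), and $d\varphi_x q_x = \alpha_{\varphi x}q_{\varphi x}$, where $\alpha_x := \|d\varphi_{\varphi^{-1}x}q_{\varphi^{-1}x}\|>0$. Pushforward: for a vector field $v$, $(d\varphi\, v)_x := d\varphi_{\varphi^{-1}x}v_{\varphi^{-1}x}$. Bounded means bounded in supremum norm over points. Unstable derivative: for each $x\in\Lambda$, $\Phi^x:[-\epsilon_x,\epsilon_x]\to\Lambda$ is the unit-speed parameterization of a local unstable manifold at $x$, with $\Phi^x(0)=x$ and $\frac{d}{d\xi}\Phi^x(\xi) = q_{\Phi^x(\xi)}$.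 A scalar or vector field $f$ is differentiable on the unstable manifold if $f\circ\Phi^x$ is differentiable for every $x$; its unstable derivative is $(\partial_\xi f)_x := \frac{d}{d\xi}(f\circ\Phi^x)(0)$.
   Formalization: Conclusion (3), uniform convergence of the unstable derivatives b^n, is stated under the added hypothesis that the unstable derivative of v^0 is bounded on Λ; without it (3) can fail. Conclusions (1) and (2) hold for every v^0 as stated. *)

(* Defs.v *)
From HB Require Import structures.
From mathcomp Require Import all_boot all_order all_algebra.
From mathcomp Require Import all_classical all_reals all_analysis.

Set Implicit Arguments.
Unset Strict Implicit.
Unset Printing Implicit Defensive.

Import Order.TTheory GRing.Theory Num.Theory.
Import numFieldNormedType.Exports.

Local Open Scope classical_set_scope.
Local Open Scope ring_scope.

(* R^m is ['rV[R]_m].  Its library norm is the sup norm, which gives the same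
   topology, uniform structure and differentials as the Euclidean norm; all
   metric quantities below use the Euclidean [enorm].

   M is an open subset of R^m (dim M = m, all tangent spaces being R^m).  Maps
   and fields are total functions of which only the values on M, or on Lam,
   matter; [phi] and [phiV] are mutually inverse on M. *)

Section Euclidean.
Context {R : realType} {m : nat}.
Local Notation vec := 'rV[R]_m.

Definition dot (u v : vec) : R := \sum_(i < m) u 0 i * v 0 i.
Definition enorm (v : vec) : R := Num.sqrt (dot v v).

Definition bounded_field (A : set vec) (f : vec -> vec) : Prop :=
  exists K : R, forall x, A x -> enorm (f x) <= K.

(* boundedness of df in operator norm *)
Definition bounded_differential (A : set vec) (f : vec -> vec) : Prop :=
  exists K : R, forall x, A x -> forall w : vec,
    enorm ('d f x w) <= K * enorm w.

(* C^k on an open set U: in finite dimension it suffices that the differential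
   be C^(k-1) on each fixed vector *)
Fixpoint Ck (k : nat) (U : set vec) (f : vec -> vec) : Prop :=
  match k with
  | 0%N => forall x, U x -> {for x, continuous f}
  | k'.+1 => (forall x, U x -> differentiable f x) /\
             (forall w : vec, Ck k' U (fun x => 'd f x w))
  end.

Definition diffeo (k : nat) (M : set vec) (phi phiV : vec -> vec) : Prop :=
  [/\ forall x, M x -> M (phi x) /\ phiV (phi x) = x,
      forall x, M x -> M (phiV x) /\ phi (phiV x) = x,
      Ck k M phi & Ck k M phiV].

End Euclidean.

Section Hyperbolicity.
Context {R : realType} {m : nat}.
Local Notation vec := 'rV[R]_m.
Implicit Types (M Lam : set vec) (phi phiV : vec -> vec).

(* Katok-Hasselblatt: V is a trapping neighborhood, possibly for an iterate *)
Definition attractor M phi Lam : Prop :=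
  exists V : set vec, exists N : nat,
    [/\ V `<=` M, Lam `<=` V°, (0 < N)%N,
        iter N phi @` V `<=` V &
        Lam = \bigcap_(n in [set: nat]) (iter n phi @` V)].

(* Eu x and Es x are exactly the sets of vectors with the stated decay; for n <= 0
   the iterate phi^n is written with phiV *)
Definition hyperbolic_splitting phi phiV Lam (Eu Es : vec -> {vspace vec})
    (C lam : R) : Prop :=
  forall x, Lam x ->
    [/\ (Eu x + Es x)%VS = fullv /\ (Eu x :&: Es x)%VS = 0%VS,
        \dim (Eu x) = 1%N /\ \dim (Es x) = m.-1,
        'd phi x @` [set` Eu x] = [set` Eu (phi x)] /\
        'd phi x @` [set` Es x] = [set` Es (phi x)],
        (forall v, v \in Eu x <->
          forall n : nat, enorm ('d (iter n phiV) x v) <= C * lam ^+ n * enorm v) &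
        (forall v, v \in Es x <->
          forall n : nat, enorm ('d (iter n phi) x v) <= C * lam ^+ n * enorm v)].

Definition hyperbolic_attractor M phi phiV Lam Eu Es : Prop :=
  [/\ compact Lam, Lam `<=` M, phi @` Lam = Lam, attractor M phi Lam &
      exists C lam : R,
        [/\ 0 < C, 0 < lam < 1 & hyperbolic_splitting phi phiV Lam Eu Es C lam]].

Definition alpha phi phiV (q : vec -> vec) (x : vec) : R :=
  enorm ('d phi (phiV x) (q (phiV x))).

Definition unstable_unit_field phi phiV Lam (Eu : vec -> {vspace vec})
    (q : vec -> vec) : Prop :=
  forall x, Lam x ->
    [/\ q x \in Eu x, enorm (q x) = 1 &
        'd phi x (q x) = alpha phi phiV q (phi x) *: q (phi x)].

Definition pushforward phi phiV (v : vec -> vec) : vec -> vec :=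
  fun x => 'd phi (phiV x) (v (phiV x)).

End Hyperbolicity.

Section UnstableManifolds.
Context {R : realType} {m : nat}.
Local Notation vec := 'rV[R]_m.
Implicit Types (M Lam : set vec) (phiV : vec -> vec).

Definition unstable_set M phiV (x : vec) : set vec :=
  [set y | M y /\ enorm (iter n phiV y - iter n phiV x) @[n --> \oo] --> (0 : R)].

Definition unstable_set_of_size M phiV (delta : R) (x : vec) : set vec :=
  [set y | M y /\ forall n : nat, enorm (iter n phiV y - iter n phiV x) <= delta].

(* W lies in the global unstable manifold of x, and is a neighborhood of x in
   it: it contains the local unstable manifold of some size *)
Definition local_unstable M phiV (x : vec) (W : set vec) : Prop :=
  W `<=` unstable_set M phiV x /\
  exists2 delta : R, 0 < delta & unstable_set_of_size M phiV delta x `<=` W.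

(* derivative relative to A: one-sided at the end points of an interval A *)
Definition is_derive_within (W : normedModType R) (A : set R) (g : R -> W)
    (t : R) (l : W) : Prop :=
  (s - t)^-1 *: (g s - g t) @[s --> within A t^'] --> l.

Definition dom (eps : vec -> R) (x : vec) : set R := `[- eps x, eps x].

(* unit speed follows from [enorm (q y) = 1] *)
Definition unstable_parameterization M phiV Lam (q : vec -> vec)
    (eps : vec -> R) (Phi : vec -> R -> vec) : Prop :=
  forall x, Lam x ->
    [/\ 0 < eps x,
        Phi x 0 = x,
        (forall xi, dom eps x xi -> Lam (Phi x xi)),
        (forall xi, dom eps x xi ->
           is_derive_within (dom eps x) (Phi x) xi (q (Phi x xi))) &
        local_unstable M phiV x (Phi x @` dom eps x)].

Definition unstable_differentiable (W : normedModType R) Lam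
    (eps : vec -> R) (Phi : vec -> R -> vec) (f : vec -> W) : Prop :=
  forall x, Lam x -> forall xi, dom eps x xi ->
    exists l : W, is_derive_within (dom eps x) (f \o Phi x) xi l.

Definition unstable_derive (W : normedModType R) (Phi : vec -> R -> vec)
    (f : vec -> W) (x : vec) : W := derive1 (f \o Phi x) 0.

End UnstableManifolds.

Section Iteration.
Context {R : realType} {m : nat}.
Local Notation vec := 'rV[R]_m.

(* [a n] is used for n >= 1 only *)
Fixpoint vseq (phi phiV q chi : vec -> vec) (a : nat -> vec -> R)
    (v0 : vec -> vec) (n : nat) : vec -> vec :=
  match n with
  | 0%N => v0
  | k.+1 => fun x => pushforward phi phiV (vseq phi phiV q chi a v0 k) x
                     + (chi x - a k.+1 x *: q x)
  end.

Definition cvg_uniformly_on (W : normedModType R) (A : set vec)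
    (f : nat -> vec -> W) : Prop :=
  exists g : vec -> W, {uniform A, f @ \oo --> g}.

End Iteration.

(* Main.v *)
Require Import Defs.
From HB Require Import structures.
From mathcomp Require Import all_boot all_order all_algebra.
From mathcomp Require Import all_classical all_reals all_analysis.
From mathcomp Require Import ring lra zify.

Set Implicit Arguments.
Unset Strict Implicit.
Unset Printing Implicit Defensive.

Import Order.TTheory GRing.Theory Num.Theory.
Import numFieldNormedType.Exports.

Local Open Scope classical_set_scope.
Local Open Scope ring_scope.

(* The component of q_y in E^s_x, for x and y on a common unstable curve,
   satisfies an exact linear recursion along backward orbits, because
   dphi q = alpha q and the projection pi onto E^s along E^u commutes with dphi.
   The recursion contracts, so its remainder vanishes without any a priori
   regularity of q; this makes q Lipschitz, then differentiable with bounded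
   derivative, on unstable curves.  A curve phi^-1 o Phi^x is locally a C^1
   reparameterization of Phi^(phi^-1 x), so unstable differentiability
   propagates through the iteration.

   For the fields, pi v^(n+1) = dphi (pi v^n) + pi chi contracts, and v^n is
   determined by pi v^n and v^n . q = 0.  The unstable derivative w^n of v^n obeys
   pi w^(n+1) = alpha^-1 dphi (pi w^n) + (terms in v^n and a^(n+1)), which contracts
   as well, while w^n . q = - v^n . dq.  All increments thus decay geometrically,
   uniformly on Lam. *)

(** * Euclidean norm *)

(** [q] is given pointwise, as a unit vector in a line field, with no continuity across points and
    no control of its sign. Two consequences shape the argument. The projection [pi z (q y)] sees
    [q y] only up to sign, so a jump to [- q] has to be excluded separately: [q] is the derivative
    of a curve, and derivatives have the intermediate value property. And integral curves of [q]
    cannot be compared by a uniqueness theorem for differential equations, since [q] is controlled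
    along one curve at a time. Charts are compared instead through backward orbits, which locate
    points in a local unstable manifold, and through injectivity of a chart, which makes the change
    of parameter continuous.

    The constant [C] may exceed 1, so a single step need not contract and estimates are made on
    iterates. In the iteration, the coefficient not yet estimated always multiplies [q], which [pi]
    annihilates; hence the fields are estimated before the coefficients, and the derivatives of the
    fields before those of the coefficients. *)

Section EuclideanNorm.
Context {R : realType} {m : nat}.
Local Notation vec := 'rV[R]_m.
Implicit Types (u v w : vec) (a : R).

Lemma dotC u v : dot u v = dot v u.
Proof. by apply: eq_bigr => i _; rewrite mulrC. Qed.

Lemma dotDl u v w : dot (u + v) w = dot u w + dot v w.
Proof. by rewrite -big_split; apply: eq_bigr => i _; rewrite mxE mulrDl. Qed.

Lemma dotZl a u w : dot (a *: u) w = a * dot u w.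
Proof. by rewrite /dot mulr_sumr; apply: eq_bigr => i _; rewrite mxE mulrA. Qed.

Lemma dotNl u w : dot (- u) w = - dot u w.
Proof. by rewrite -scaleN1r dotZl mulN1r. Qed.

Lemma dotBl u v w : dot (u - v) w = dot u w - dot v w.
Proof. by rewrite dotDl dotNl. Qed.

Lemma dotDr u v w : dot w (u + v) = dot w u + dot w v.
Proof. by rewrite dotC dotDl !(dotC w). Qed.

Lemma dotZr a u w : dot w (a *: u) = a * dot w u.
Proof. by rewrite dotC dotZl (dotC w). Qed.

Lemma dotBr u v w : dot w (u - v) = dot w u - dot w v.
Proof. by rewrite dotC dotBl !(dotC w). Qed.

Lemma dot0l w : dot 0 w = 0.
Proof. by rewrite -[X in dot X](scale0r w) dotZl mul0r. Qed.

Lemma dotvv_ge0 v : 0 <= dot v v.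
Proof. by apply: sumr_ge0 => i _; rewrite -expr2 sqr_ge0. Qed.

Lemma enorm_ge0 v : 0 <= enorm v.
Proof. exact: sqrtr_ge0. Qed.

Lemma sqr_enorm v : enorm v ^+ 2 = dot v v.
Proof. by rewrite sqr_sqrtr ?dotvv_ge0. Qed.

Lemma coord_le_enorm v i : `|v 0 i| <= enorm v.
Proof.
rewrite -(ler_pXn2r (n := 2)) ?nnegrE ?enorm_ge0// sqr_enorm real_normK ?num_real//.
rewrite /dot (bigD1 i)//= -expr2 lerDl sumr_ge0// => j _.
by rewrite -expr2 sqr_ge0.
Qed.

Lemma enorm_eq0 v : enorm v = 0 -> v = 0.
Proof.
move=> v0; apply/rowP => i; rewrite mxE; apply/eqP; rewrite -normr_le0 -v0.
exact: coord_le_enorm.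
Qed.

Lemma enorm0 : enorm (0 : vec) = 0.
Proof. by rewrite /enorm dot0l sqrtr0. Qed.

Lemma enormZ a v : enorm (a *: v) = `|a| * enorm v.
Proof.
by rewrite /enorm dotZl dotZr mulrA -expr2 sqrtrM ?sqr_ge0// sqrtr_sqr.
Qed.

Lemma enormN v : enorm (- v) = enorm v.
Proof. by rewrite -scaleN1r enormZ normrN1 mul1r. Qed.

Lemma enormB u v : enorm (u - v) = enorm (v - u).
Proof. by rewrite -enormN opprB. Qed.

Lemma ler_dot_enorm u v : `|dot u v| <= enorm u * enorm v.
Proof.
have [v0|v0] := eqVneq (enorm v) 0.
  by rewrite (enorm_eq0 v0) dotC dot0l normr0 enorm0 mulr0.
have v_gt0 : 0 < dot v v by rewrite -sqr_enorm exprn_gt0// lt_def v0 enorm_ge0.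
rewrite -(ler_pXn2r (n := 2)) ?nnegrE ?mulr_ge0 ?enorm_ge0//.
rewrite exprMn !sqr_enorm real_normK ?num_real//.
have := dotvv_ge0 (u - (dot u v / dot v v) *: v).
rewrite dotBl !dotBr !dotZl !dotZr (dotC v u).
set p := dot u v; set b := dot v v; set c := dot u u.
rewrite (_ : _ - _ - _ = c - p ^+ 2 / b); last by field; rewrite gt_eqF.
by rewrite subr_ge0 ler_pdivrMr.
Qed.

Lemma ler_dot u v : dot u v <= enorm u * enorm v.
Proof. exact: le_trans (ler_norm _) (ler_dot_enorm u v). Qed.

Lemma ler_enormD u v : enorm (u + v) <= enorm u + enorm v.
Proof.
rewrite -(ler_pXn2r (n := 2)) ?nnegrE ?addr_ge0 ?enorm_ge0//.
rewrite sqr_enorm dotDl !dotDr (dotC v u) sqrrD !sqr_enorm.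
have := ler_dot u v; lra.
Qed.

Lemma ler_enorm_sum (I : Type) (r : seq I) (P : pred I) (F : I -> vec) :
  enorm (\sum_(i <- r | P i) F i) <= \sum_(i <- r | P i) enorm (F i).
Proof.
elim/big_rec2: _ => [|i y1 y2 _ le12]; first by rewrite enorm0.
by apply: le_trans (ler_enormD _ _) _; rewrite lerD2l.
Qed.

Lemma norm_le_enorm v : `|v| <= enorm v.
Proof.
rewrite -[`|v|]/(mx_norm v); have [->|/mx_norm_neq0[[i j] ->]] := eqVneq (mx_norm v) 0.
  exact: enorm_ge0.
by rewrite ord1 coord_le_enorm.
Qed.

Lemma coord_le_norm v i : `|v 0 i| <= `|v|.
Proof.
rewrite -[leRHS]/(mx_norm v) mx_normrE.
exact: (le_trans _ (le_bigmax _ _ (0, i))).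
Qed.

Lemma enorm_le_norm v : enorm v <= m%:R * `|v|.
Proof.
rewrite {1}(row_sum_delta v); apply: le_trans (ler_enorm_sum _ _ _) _.
rewrite -[m in m%:R]card_ord mulr_natl -sumr_const; apply: ler_sum => i _.
rewrite enormZ (_ : enorm _ = 1) ?mulr1 ?coord_le_norm// /enorm /dot.
rewrite (bigD1 i)//= big1 => [|j /negPf ji]; last by rewrite !mxE ji andbF mulr0.
by rewrite !mxE !eqxx mulr1 addr0 sqrtr1.
Qed.

End EuclideanNorm.

Section Limits.
Context {R : realType} {m : nat}.
Local Notation vec := 'rV[R]_m.
Context {T : Type} {F : set_system T} {FF : Filter F}.

Lemma cvg_dot (f g : T -> vec) u v :
  f @ F --> u -> g @ F --> v -> dot (f x) (g x) @[x --> F] --> dot u v.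
Proof.
move=> fu gv; apply: cvg_big => [|i _]; first exact: add_continuous.
apply: cvgM.
  exact: (cvg_comp _ _ fu (@coord_continuous _ _ _ _ _ _)).
exact: (cvg_comp _ _ gv (@coord_continuous _ _ _ _ _ _)).
Qed.

Lemma cvg_enorm (f : T -> vec) u :
  f @ F --> u -> enorm (f x) @[x --> F] --> enorm u.
Proof.
move=> fu; exact: (cvg_comp _ _ (cvg_dot fu fu) (@sqrt_continuous R _)).
Qed.

End Limits.

(** * Derivatives relative to an interval *)

Section WithinDerivative.
Context {R : realType}.
Implicit Types (A : set R) (t : R).

Lemma near_within_dnbhs A t (P : set R) :
  (\forall s \near t, s != t -> A s -> P s) -> \forall s \near within A t^', P s.
Proof. by []. Qed.

Lemma near_within_neq A t : \forall s \near within A t^', s != t.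
Proof. by apply: near_within_dnbhs; near=> s. Unshelve. all: by end_near. Qed.

Lemma near_within_mem A t : \forall s \near within A t^', A s.
Proof. by apply: near_within_dnbhs; near=> s. Unshelve. all: by end_near. Qed.

Lemma cvg_within_id A t : s @[s --> within A t^'] --> t.
Proof.
move=> U tU; apply: near_within_dnbhs; near=> s => _ _; near: s; exact: tU.
Unshelve. all: by end_near. Qed.

Section Rules.
Context {W : normedModType R}.
Implicit Types (g h : R -> W) (l : W).

Lemma derive_within_cvg A g t l : is_derive_within A g t l ->
  g s @[s --> within A t^'] --> g t.
Proof.
move=> gl.
have H : g t + (s - t) *: ((s - t)^-1 *: (g s - g t)) @[s --> within A t^']
     --> g t + (t - t) *: l.
  apply: cvgD; first exact: cvg_cst.
  apply: cvgZ => //; apply: cvgB; [exact: cvg_within_id|exact: cvg_cst].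
rewrite subrr scale0r addr0 in H.
apply: cvg_trans H; apply: near_eq_cvg.
near=> s; have st : s - t != 0 by rewrite subr_eq0; near: s; exact: near_within_neq.
by rewrite scalerA divff// scale1r addrC subrK.
Unshelve. all: by end_near. Qed.

Lemma derive_within_cvg_nbhs A g t l : is_derive_within A g t l ->
  g s @[s --> within A (nbhs t)] --> g t.
Proof.
move=> /derive_within_cvg gt U gU.
have H : \forall s \near t, s != t -> A s -> U (g s) := gt U gU.
change (\forall s \near t, A s -> U (g s)); near=> s => As.
have [->|st] := eqVneq s t; first exact: nbhs_singleton.
have : s != t -> A s -> U (g s) by near: s.
by apply.
Unshelve. all: by end_near. Qed.

Lemma derive_within_continuous A g (g' : R -> W) :
  (forall t, A t -> is_derive_within A g t (g' t)) -> {within A, continuous g}.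
Proof.
by move=> gg'; apply/subspace_continuousP => t At; exact: derive_within_cvg_nbhs (gg' t At).
Qed.

Lemma derive_within_cst A (w : W) t : is_derive_within A (fun=> w) t 0.
Proof.
by rewrite /is_derive_within; under eq_fun do rewrite subrr scaler0; exact: cvg_cst.
Qed.

Lemma derive_withinD A g h t l k : is_derive_within A g t l ->
  is_derive_within A h t k -> is_derive_within A (fun s => g s + h s) t (l + k).
Proof.
move=> gl hk; rewrite /is_derive_within.
under eq_fun do rewrite opprD addrACA scalerDr; exact: cvgD.
Qed.

Lemma derive_withinN A g t l : is_derive_within A g t l ->
  is_derive_within A (fun s => - g s) t (- l).
Proof.
move=> gl; rewrite /is_derive_within.
under eq_fun do rewrite -opprD scalerN; exact: cvgN.
Qed.

Lemma derive_withinB A g h t l k : is_derive_within A g t l ->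
  is_derive_within A h t k -> is_derive_within A (fun s => g s - h s) t (l - k).
Proof. by move=> gl hk; apply: derive_withinD => //; exact: derive_withinN. Qed.

Lemma derive_within_sum A (I : Type) (r : seq I) (g : I -> R -> W) t (l : I -> W) :
  (forall i, is_derive_within A (g i) t (l i)) ->
  is_derive_within A (fun s => \sum_(i <- r) g i s) t (\sum_(i <- r) l i).
Proof.
move=> gl; elim: r => [|i r IH].
  by under eq_fun do rewrite big_nil; rewrite big_nil; exact: derive_within_cst.
under eq_fun do rewrite big_cons; rewrite big_cons; exact: derive_withinD.
Qed.

Lemma eq_derive_within A g h t l : A t -> (forall s, A s -> g s = h s) ->
  is_derive_within A g t l -> is_derive_within A h t l.
Proof.
move=> At gh gl; apply: cvg_trans gl; apply: near_eq_cvg; near=> s.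
have As : A s by near: s; exact: near_within_mem.
by rewrite !gh.
Unshelve. all: by end_near. Qed.

Lemma derive_withinS A B g t l : B `<=` A -> is_derive_within A g t l ->
  is_derive_within B g t l.
Proof.
move=> BA gl U /gl; rewrite /= !nbhs_simpl /within /=.
by apply: filterS => s H Bs; apply: H; exact: BA.
Qed.

Lemma derive_within_interior A t : nbhs t A -> within A t^' = t^'.
Proof.
move=> At; rewrite eqEsubset; split => U tU.
  have H : \forall s \near t, s != t -> A s -> U s := tU.
  change (\forall s \near t, s != t -> U s); near=> s => st.
  have : s != t -> A s -> U s by near: s.
  by apply => //; near: s.
have H : \forall s \near t, s != t -> U s := tU.
change (\forall s \near t, s != t -> A s -> U s); near=> s => st _.
by move: st; near: s.
Unshelve. all: by end_near. Qed.

(** The link to two-sided derivatives, needed to apply the mean value theorem and to reach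
    [unstable_derive], which is defined by [derive1]. *)
Lemma is_derive_within_interior A g t l : nbhs t A ->
  is_derive_within A g t l <-> is_derive t 1 g l.
Proof.
move=> At; rewrite /is_derive_within derive_within_interior//.
have shift0 : (fun h : R => h^-1 *: ((g \o shift t) (h *: 1) - g t)) @ 0^' =
   (s - t)^-1 *: (g s - g t) @[s --> t^'].
  pose G s := (s - t)^-1 *: (g s - g t).
  have E (h : R) : h^-1 *: ((g \o shift t) (h *: 1) - g t) = G (h + t).
    by rewrite /G /= scaler1 addrK.
  under eq_fun do rewrite E.
  rewrite eqEsubset; split => U H.
    have {}H : \forall h \near (0 : R), h != 0 -> U (G (h + t)) := H.
    change (\forall s \near t, s != t -> U (G s)); move: H.
    rewrite [in X in _ -> X](near_shift 0 t)/= subr0.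
    by apply: filterS => h + ht; apply; apply: contra_neq ht => ->; rewrite add0r.
  have {}H : \forall s \near t, s != t -> U (G s) := H.
  change (\forall h \near (0 : R), h != 0 -> U (G (h + t))); move: H.
  rewrite [X in X -> _](near_shift 0 t)/= subr0.
  by apply: filterS => h + h0; apply; rewrite -subr_eq0 addrK.
split.
  move=> gl; have := gl; rewrite -shift0 => gl'.
  apply: DeriveDef; first by apply/cvg_ex; exists l.
  exact: (cvg_lim _ gl').
by move=> [dg <-]; rewrite -shift0; exact: dg.
Qed.

End Rules.

Lemma derive_withinZ (W : normedModType R) A (a : R -> R) (g : R -> W) t a' l :
  is_derive_within A a t a' -> is_derive_within A g t l ->
  is_derive_within A (fun s => a s *: g s) t (a t *: l + a' *: g t).
Proof.
move=> aa' gl; rewrite /is_derive_within.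
have E s : (s - t)^-1 *: (a s *: g s - a t *: g t) =
    a s *: ((s - t)^-1 *: (g s - g t)) + ((s - t)^-1 * (a s - a t)) *: g t.
  rewrite !scalerA (mulrC (a s)) -!scalerA -scalerDr; congr (_ *: _).
  by rewrite scalerBr scalerBl addrA subrK.
under eq_fun do rewrite E.
apply: cvgD; first by apply: cvgZ => //; exact: derive_within_cvg aa'.
by apply: cvgZ; [exact: aa'|exact: cvg_cst].
Qed.


End WithinDerivative.

(** * Chain rules, mean values and the sign of a derivative *)

Section ChainRules.
Context {R : realType}.
Implicit Types (A D : set R) (t : R).

Lemma diff_near_le (V W : normedModType R) (f : V -> W) (x : V) (e : R) :
  differentiable f x -> 0 < e ->
  \forall y \near x, `|f y - f x - 'd f x (y - x)| <= e * `|y - x|.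
Proof.
move=> /diff_locally/eqaddoP/(_ e) H e0; have {H} := H e0 => H.
have {}H : \forall h \near (0 : V), `|f (h + x) - f x - 'd f x h| <= e * `|h|.
  move: H; apply: filterS => h /=.
  by rewrite !fctE/= /cst/= opprD addrA.
rewrite (near_shift 0 x)/= subr0; move: H; apply: filterS => h /=.
by rewrite addrK.
Qed.

Lemma derive_within_diff (V W : normedModType R) (f : V -> W) (c : R -> V) A t l :
  differentiable f (c t) -> is_derive_within A c t l ->
  is_derive_within A (f \o c) t ('d f (c t) l).
Proof.
move=> df cl; rewrite /is_derive_within.
pose E s := (s - t)^-1 *: (f (c s) - f (c t) - 'd f (c t) (c s - c t)).
have split s : (s - t)^-1 *: ((f \o c) s - (f \o c) t) =
    E s + 'd f (c t) ((s - t)^-1 *: (c s - c t)).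
  by rewrite linearZ/= /E -scalerDr subrK.
under eq_fun do rewrite split.
rewrite -['d f (c t) l]add0r; apply: cvgD; last first.
  have dc : continuous ('d f (c t)) by exact: diff_continuous.
  exact: (cvg_comp _ _ cl (dc l)).
have l1 : 0 < `|l| + 1 by rewrite ltr_wpDl.
apply/cvgr0Pnorm_le => e e0; near=> s.
have H1 : `|f (c s) - f (c t) - 'd f (c t) (c s - c t)| <= e / (`|l| + 1) * `|c s - c t|.
  near: s; have := diff_near_le df (divr_gt0 e0 l1).
  exact: (derive_within_cvg cl).
have H2 : `|(s - t)^-1 *: (c s - c t)| <= `|l| + 1.
  by near: s; apply: (cvgr_norm_le _ cl); rewrite ltrDl.
rewrite normrZ in H2; rewrite /E normrZ; apply: (le_trans (ler_wpM2l (normr_ge0 _) H1)).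
rewrite mulrCA -[leRHS](divfK (lt0r_neq0 l1)); apply: ler_wpM2l => //.
by rewrite ltW// divr_gt0.
Unshelve. all: by end_near. Qed.

Lemma derive_within_coord m A (g : R -> 'rV[R]_m) t l i : is_derive_within A g t l ->
  is_derive_within A (fun s => g s 0 i) t (l 0 i).
Proof.
move=> gl; rewrite /is_derive_within.
have E s : (s - t)^-1 *: (g s 0 i - g t 0 i) = ((s - t)^-1 *: (g s - g t)) 0 i.
  by rewrite !mxE.
under eq_fun do rewrite E.
exact: (cvg_comp _ _ gl (@coord_continuous _ _ _ _ _ _)).
Qed.

Lemma derive_within_dot m A (g h : R -> 'rV[R]_m) t l k :
  is_derive_within A g t l -> is_derive_within A h t k ->
  is_derive_within A (fun s => dot (g s) (h s)) t (dot (g t) k + dot l (h t)).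
Proof.
move=> gl hk; rewrite /dot -big_split/=.
have := @derive_within_sum R R A _ (index_enum 'I_m) (fun i s => g s 0 i * h s 0 i)
  t (fun i => g t 0 i * k 0 i + l 0 i * h t 0 i).
apply=> i; exact: (@derive_withinZ R R A _ _ _ _ _
  (derive_within_coord (i := i) gl) (derive_within_coord (i := i) hk)).
Qed.

(** Strictly between [x] and [y] the relative derivative is two-sided; at the end points only
    continuity is required. *)
Lemma derive_within_mvt A (h h' : R -> R) (x y : R) : is_interval A ->
  (forall s, A s -> is_derive_within A h s (h' s)) ->
  A x -> A y -> x < y ->
  exists z, [/\ A z, x < z, z < y & h y - h x = h' z * (y - x)].
Proof.
move=> iA hh' Ax Ay xy.
have sub : `[x, y]%classic `<=` A.
  by move=> z /= /andP[]; rewrite !bnd_simp => xz zy; apply: (iA x y) => //; rewrite xz.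
have [||z zxy E] := @MVT R h h' x y xy.
- move=> z zxy; apply/(@is_derive_within_interior R R A).
    apply: filterS (near_in_itvoo zxy) => u uxy; apply: sub.
    by apply: subset_itv_oo_cc uxy.
  by apply: hh'; apply: sub; exact: subset_itv_oo_cc zxy.
- apply: (@derive_within_continuous R R _ h h') => s sxy.
  by apply: (derive_withinS sub); apply: hh'; exact: sub.
exists z; split => //; rewrite ?(itvP zxy)//.
by apply: sub; exact: subset_itv_oo_cc zxy.
Qed.

(** Pairing [c] with the fixed vector [c y - c x] reduces the bound to the scalar mean value
    theorem. *)
Lemma derive_within_lipschitz m A (c c' : R -> 'rV[R]_m) (B x y : R) : is_interval A ->
  (forall s, A s -> is_derive_within A c s (c' s)) ->
  (forall s, A s -> enorm (c' s) <= B) ->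
  A x -> A y -> enorm (c y - c x) <= B * `|y - x|.
Proof.
move=> iA cc' c'B; wlog xy : x y / x <= y.
  move=> H; have [/H//|/ltW /H yx Ax Ay] := leP x y.
  by rewrite enormB distrC; exact: yx.
move=> Ax Ay; move: xy; rewrite le_eqVlt => /predU1P[->|xy].
  by rewrite !subrr enorm0 normr0 mulr0.
set w := c y - c x.
have dw s : A s -> is_derive_within A (fun s => dot (c s) w) s (dot (c' s) w).
  move=> As; have := derive_within_dot (cc' s As) (derive_within_cst A w s).
  by rewrite (dotC _ 0) dot0l add0r.
have [z [Az _ _]] := derive_within_mvt iA dw Ax Ay xy.
rewrite -dotBl -/w -sqr_enorm => E.
have [->|w0] := eqVneq (enorm w) 0.
  by rewrite mulr_ge0// (le_trans (enorm_ge0 (c' z)))// c'B.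
have {}w0 : 0 < enorm w by rewrite lt_def w0 enorm_ge0.
rewrite -(ler_pM2r w0) -expr2 E ger0_norm; last by rewrite subr_ge0 ltW.
rewrite [leRHS]mulrAC; apply: ler_wpM2r; first by rewrite subr_ge0 ltW.
by rewrite (le_trans (ler_dot _ _))// ler_wpM2r ?enorm_ge0// c'B.
Qed.

(** Only the limit of [tau] is assumed. Its difference quotient is recovered from the curves: the
    quotient of [c] paired with [e], divided by that of [Phi] paired with [e], which tends to
    [dot e e = 1]. *)
Lemma derive_within_reparam (m : nat) (W : normedModType R) (f : 'rV[R]_m -> W)
    (D A : set R) (Phi c : R -> 'rV[R]_m) (tau : R -> R) (t0 t beta : R)
    (e : 'rV[R]_m) (l : W) :
  is_derive_within D (f \o Phi) t0 l -> is_derive_within D Phi t0 e -> enorm e = 1 ->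
  is_derive_within A c t (beta *: e) -> Phi t0 = c t ->
  (\forall s \near within A t^', D (tau s) /\ Phi (tau s) = c s) ->
  tau s @[s --> within A t^'] --> t0 ->
  is_derive_within A (f \o c) t (beta *: l).
Proof.
move=> fl Phie e1 cb Pt Dtau tau0.
(* The value [k] at [t0] matters: [tau s = t0] may occur for [s != t], for instance when
   [beta = 0]. *)
pose Q (V : normedModType R) (g : R -> V) k (u : R) :=
  if u == t0 then k else (u - t0)^-1 *: (g u - g t0).
have QE (V : normedModType R) (g : R -> V) k u : g u - g t0 = (u - t0) *: Q V g k u.
  rewrite /Q; case: eqP => [->|/eqP ut]; first by rewrite !subrr scale0r.
  by rewrite scalerA divff ?scale1r// subr_eq0.
have tauD : tau s @[s --> within A t^'] --> within D (nbhs t0).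
  move=> U DU; have {DU} H : \forall u \near t0, D u -> U u := DU.
  have {}H := tau0 _ H.
  change (\forall s \near within A t^', U (tau s)).
  near=> s; have : D (tau s) -> U (tau s) by near: s; exact: H.
  have [Ds _] : D (tau s) /\ Phi (tau s) = c s by near: s.
  by apply.
have Qcvg (V : normedModType R) (g : R -> V) k : is_derive_within D g t0 k ->
    Q V g k (tau s) @[s --> within A t^'] --> k.
  move=> gk; apply: (@cvg_comp _ _ _ tau (Q V g k) _ _ _ tauD).
  move=> U kU; have gU := gk U kU.
  have H : \forall u \near t0, u != t0 -> D u -> U ((u - t0)^-1 *: (g u - g t0)) := gU.
  change (\forall u \near t0, D u -> U (Q V g k u)).
  near=> u => Du; rewrite /Q; case: eqP => [_|/eqP ut0]; first exact: nbhs_singleton.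
  have : u != t0 -> D u -> U ((u - t0)^-1 *: (g u - g t0)) by near: u.
  by apply.
pose rho s := dot ((s - t)^-1 *: (c s - c t)) e / dot (Q _ Phi e (tau s)) e.
have He : dot (Q _ Phi e (tau s)) e @[s --> within A t^'] --> (1 : R).
  have <- : dot e e = 1 by rewrite -sqr_enorm e1 expr1n.
  by apply: cvg_dot; [exact: Qcvg|exact: cvg_cst].
have rhob : rho s @[s --> within A t^'] --> beta.
  have <- : dot (beta *: e) e / 1 = beta.
    by rewrite dotZl -sqr_enorm e1 expr1n mulr1 divr1.
  apply: cvgM; last by apply: cvgV => //; exact: oner_neq0.
  by apply: cvg_dot => //; exact: cvg_cst.
have H : rho s *: Q _ (f \o Phi) l (tau s) @[s --> within A t^'] --> beta *: l.
  by apply: cvgZ => //; exact: Qcvg.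
apply: cvg_trans H; apply: near_eq_cvg; near=> s.
have [_ Ps] : D (tau s) /\ Phi (tau s) = c s by near: s.
have st : s - t != 0 by rewrite subr_eq0; near: s; exact: near_within_neq.
have nz : dot (Q _ Phi e (tau s)) e != 0.
  near: s; have := cvgr_neq0 _ He (oner_neq0 _); exact.
rewrite /= -Ps -Pt (QE _ (f \o Phi) l) scalerA; congr (_ *: _).
rewrite /rho -Ps -Pt (QE _ Phi e) !dotZl; field; exact/andP.
Unshelve. all: by end_near. Qed.

(** The segment from [s] towards [u] stays in [A] and supplies points other than [s] in every
    neighborhood of [s]. *)
Lemma within_dnbhs_proper A s u : is_interval A -> A s -> A u -> u != s ->
  ProperFilter (within A s^').
Proof.
move=> iA As Au us; apply: Build_ProperFilter_ex => P sP.
have {}sP : \forall v \near s, v != s -> A v -> P v := sP.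
have path : s + d * (u - s) @[d --> (0 : R)^'+] --> s.
  have path : s + d * (u - s) @[d --> (0 : R)^'+] --> s + 0 * (u - s).
    apply: cvgD; first exact: cvg_cst.
    by apply: cvgM; [exact: cvg_at_right_filter cvg_id|exact: cvg_cst].
  by move: path; rewrite mul0r addr0.
have Hd : \forall d \near (0 : R)^'+, s + d * (u - s) != s -> A (s + d * (u - s)) ->
  P (s + d * (u - s)) := path _ sP.
near (0 : R)^'+ => d; exists (s + d * (u - s)).
have d0 : 0 < d by near: d; exact: nbhs_right_gt.
have d1 : d < 1 by near: d; exact: nbhs_right_lt.
have : s + d * (u - s) != s -> A (s + d * (u - s)) -> P (s + d * (u - s)) by near: d.
apply.
  rewrite -subr_eq0 addrAC subrr add0r; apply: mulf_neq0; last by rewrite subr_eq0.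
  by rewrite gt_eqF.
have [su|su] := leP s u.
  by apply: (iA s u) => //; apply/andP; split; nra.
by apply: (iA u s) => //; apply/andP; split; nra.
Unshelve. all: by end_near. Qed.

(** Darboux's argument, with no continuity of [h']. The mean value theorem makes [h] injective
    between [s] and [t], hence monotone, so all its difference quotients there have one sign. *)
Lemma derive_within_sign A (h h' : R -> R) s t : is_interval A ->
  (forall u, A u -> is_derive_within A h u (h' u)) ->
  (forall u, A u -> h' u != 0) -> A s -> A t -> 0 < h' s -> 0 < h' t.
Proof.
move=> iA hh' h'0 As At hs.
have [<-//|st] := eqVneq s t.
pose I := `[Num.min s t, Num.max s t].
have Is : s \in I by rewrite in_itv/= ge_min le_max !lexx.
have It : t \in I by rewrite in_itv/= ge_min le_max !lexx !orbT.
have IA : [set` I] `<=` A.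
  move=> u; rewrite /I /= in_itv/= ge_min le_max => /andP[/orP[su|tu] /orP[us|ut]].
  - by have -> : u = s by apply/eqP; rewrite eq_le su us.
  - by apply: (iA s t) => //; rewrite su.
  - by apply: (iA t s) => //; rewrite tu.
  - by have -> : u = t by apply/eqP; rewrite eq_le tu ut.
have iI : is_interval [set` I] by exact: interval_is_interval.
have dI u : [set` I] u -> is_derive_within [set` I] h u (h' u).
  by move=> Iu; apply: (derive_withinS IA); apply: hh'; exact: IA.
have hinj x y : x \in I -> y \in I -> x < y -> h x != h y.
  move=> xI yI xy; have [z [zI _ _]] := derive_within_mvt iI dI xI yI xy.
  move=> E; rewrite eq_sym -subr_eq0 E mulf_neq0 ?h'0//; first exact: IA.
  by rewrite subr_eq0 gt_eqF.
have hI : {in I &, injective h}.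
  move=> x y xI yI hxy; have [xy|yx|//] := ltgtP x y.
    by have := hinj _ _ xI yI xy; rewrite hxy eqxx.
  by have := hinj _ _ yI xI yx; rewrite hxy eqxx.
have sP : ProperFilter (within [set` I] s^') 
  by apply: (within_dnbhs_proper iI Is It); rewrite eq_sym.
have tP : ProperFilter (within [set` I] t^') by exact: (within_dnbhs_proper iI It Is).
have [mono|mono] := itv_continuous_inj_mono (derive_within_continuous dI) hI.
  rewrite lt_def h'0//=; apply: (cvgr_to_ge (dI t It)); near=> u.
  have ut : u != t by near: u; exact: near_within_neq.
  have uI : u \in I by near: u; exact: near_within_mem.
  have [lut|ltu|e] := ltgtP u t; last by rewrite e eqxx in ut.
    by apply: mulr_le0; rewrite ?invr_le0 subr_le0 ltW// mono.
  by apply: mulr_ge0; rewrite ?invr_ge0 subr_ge0 ltW// mono.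
have : h' s <= 0; last by rewrite leNgt hs.
apply: (cvgr_to_le (dI s Is)); near=> u.
have us : u != s by near: u; exact: near_within_neq.
have uI : u \in I by near: u; exact: near_within_mem.
have [lut|ltu|e] := ltgtP u s; last by rewrite e eqxx in us.
  by apply: mulr_le0_ge0; rewrite ?invr_le0 ?subr_le0 ?subr_ge0 ltW// mono.
by apply: mulr_ge0_le0; rewrite ?invr_ge0 ?subr_le0 ?subr_ge0 ltW// mono.
Unshelve. all: by end_near. Qed.

End ChainRules.

(** A function approximated within every [e] by convergent ones is Cauchy along [F]. This gives the
    limit of a series whose terms converge one by one, without a candidate for the sum. *)
Lemma cvg_near_approx {R : realType} m (T : Type)
    (F : set_system T) (FF : ProperFilter F) (f : T -> 'rV[R]_m) :
  (forall e : R, 0 < e -> exists g : T -> 'rV[R]_m,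
     cvg (g @ F) /\ \forall x \near F, `|f x - g x| <= e) ->
  cvg (f @ F).
Proof.
move=> H; apply: cauchy_cvg; apply: cauchy_exP => e e0.
have e2 : 0 < e / 2 by rewrite divr_gt0.
have [g [/cvg_ex[l gl] fg]] := H _ e2.
exists l; change (\forall x \near F, ball l e (f x)); near=> x.
rewrite -ball_normE /ball_/= -(subrK (g x) l) -addrA (le_lt_trans (ler_normD _ _))//.
rewrite (splitr e) ltr_leD//; last by rewrite distrC; near: x.
by near: x; move/cvgrPdist_lt: gl; apply.
Unshelve. all: by end_near. Qed.

(** * Geometric decay and uniform convergence *)

Section GeometricConvergence.
Context {R : realType} {m : nat} {W : normedModType R}.
Hypothesis W_complete : forall u : nat -> W, cauchy (u @ \oo) -> cvg (u @ \oo).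

Lemma geometric_dist (u : nat -> W) (K r : R) n k : 0 <= K -> 0 < r < 1 ->
  (forall n, `|u n.+1 - u n| <= K * r ^+ n) ->
  `|u (n + k)%N - u n| <= K / (1 - r) * r ^+ n.
Proof.
move=> K0 /andP[r0 r1] uK; have r1' : 0 < 1 - r by rewrite subr_gt0.
(* The induction on [k] needs the exact geometric sum; the stated bound drops its negative term. *)
apply: (@le_trans _ _ (K / (1 - r) * (r ^+ n - r ^+ (n + k)))); last first.
  by rewrite ler_wpM2l ?divr_ge0 ?(ltW r1')// gerDl oppr_le0 exprn_ge0// ltW.
elim: k => [|k IH]; first by rewrite addn0 !subrr normr0 mulr0.
rewrite addnS -(subrK (u (n + k)%N) (u (n + k).+1)) -addrA.
apply: le_trans (ler_normD _ _) _.
apply: le_trans (lerD (uK _) IH) _.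
rewrite exprS le_eqVlt; apply/orP; left; apply/eqP; field.
by rewrite subr_eq0 eq_sym lt_eqF.
Qed.

Lemma geometric_cvg (u : nat -> W) (K r : R) : 0 <= K -> 0 < r < 1 ->
  (forall n, `|u n.+1 - u n| <= K * r ^+ n) ->
  exists2 l, u @ \oo --> l & forall n, `|l - u n| <= K / (1 - r) * r ^+ n.
Proof.
move=> K0 r01 uK; have D := fun n k => geometric_dist n k K0 r01 uK.
have small (e : R) : 0 < e -> \forall n \near \oo, K / (1 - r) * r ^+ n < e.
  move=> e0; case/andP: r01 => r0 r1.
  have H : K / (1 - r) * r ^+ n @[n --> \oo] --> K / (1 - r) * 0.
    by apply: cvgM; [exact: cvg_cst|apply: cvg_expr; rewrite ger0_norm// ltW].
  rewrite mulr0 in H; move/cvgr0Pnorm_lt: H => /(_ _ e0); apply: filterS => n.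
  exact/le_lt_trans/ler_norm.
have /cvg_ex[l ul] : cvg (u @ \oo).
  apply: W_complete; apply: cauchy_exP => e e0.
  have [N _ HN] := small e e0.
  exists (u N); exists N => // n /= Nn.
  rewrite -ball_normE /ball_/= distrC -(subnKC Nn).
  by apply: le_lt_trans (D _ _) _; apply: HN => /=.
exists l => // n.
have H : `|u k - u n| @[k --> \oo] --> `|l - u n|.
  by apply: cvg_norm; apply: cvgB => //; exact: cvg_cst.
apply: (cvgr_to_le H); exists n => // k /= nk.
by rewrite -(subnKC nk); exact: D.
Qed.

(** Increments are controlled from index 1 on, because the sequences of coefficients only start
    there. *)
Lemma geometric_cvg_uniformly_on (A : set 'rV[R]_m) (f : nat -> 'rV[R]_m -> W)
    (K r : R) : 0 <= K -> 0 < r < 1 ->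
  (forall n x, A x -> `|f n.+2 x - f n.+1 x| <= K * r ^+ n) -> cvg_uniformly_on A f.
Proof.
move=> K0 r01 fK.
have /choice[g Hg] : forall x, exists l, A x -> forall n,
    `|l - f n.+1 x| <= K / (1 - r) * r ^+ n.
  move=> x; have [Ax|nAx] := pselect (A x); last by exists 0.
  have [l _ Hl] := geometric_cvg K0 r01 (fun n => fK n x Ax).
  by exists l.
exists g => P /uniform_nbhs[E [+ EP]]; rewrite -entourage_ballE => -[e e0 eE].
have H : K / (1 - r) * r ^+ n @[n --> \oo] --> K / (1 - r) * 0.
  case/andP: r01 => r0 r1.
  by apply: cvgM; [exact: cvg_cst|apply: cvg_expr; rewrite ger0_norm// ltW].
rewrite mulr0 in H; move/cvgr0Pnorm_lt: H => /(_ _ e0)[N _ HN].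
exists N.+1 => // -[//|n] /= Nn; apply: EP => x Ax; apply: eE => /=.
rewrite -ball_normE /ball_/=; apply: le_lt_trans (Hg x Ax n) _.
exact: le_lt_trans (ler_norm _) (HN n Nn).
Qed.

End GeometricConvergence.

Section CompactBound.
Context {R : realType}.

Lemma compact_enorm_le (m k : nat) (A : set 'rV[R]_m) (f : 'rV[R]_m -> 'rV[R]_k) :
  compact A -> (forall x, A x -> {for x, continuous f}) ->
  exists2 K : R, 0 <= K & forall x, A x -> enorm (f x) <= K.
Proof.
move=> cA fA.
have : compact (f @` A).
  apply: continuous_compact => //; apply/subspace_continuousP => x Ax.
  by apply: cvg_within_filter; exact: fA.
move=> /compact_bounded[N [_ HN]].
have N1 : N < `|N| + 1 by rewrite (le_lt_trans (ler_norm N))// ltrDl.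
exists (k%:R * (`|N| + 1)); first by rewrite mulr_ge0// addr_ge0.
move=> x Ax; apply: le_trans (enorm_le_norm _) _; apply: ler_wpM2l => //.
by apply: HN N1 _ _; exists x.
Qed.

End CompactBound.

(* Sealing the differential keeps unification from unfolding the topology of
   'rV[R]_m whenever two base points fail to match. *)
HB.lock Definition dmap {R : realType} {m : nat} (f : 'rV[R]_m -> 'rV[R]_m)
  (x v : 'rV[R]_m) : 'rV[R]_m := 'd f x v.

(** * The differential as a linear map, and its bounds on compact sets *)

Section Dmap.
Context {R : realType} {m : nat}.
Local Notation vec := 'rV[R]_m.
Implicit Types (f g : vec -> vec) (x u v : vec) (a : R).

Lemma dmapE f x v : dmap f x v = 'd f x v.
Proof. by rewrite dmap.unlock. Qed.

Lemma dmapD f x u v : dmap f x (u + v) = dmap f x u + dmap f x v.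
Proof. by rewrite dmap.unlock linearD. Qed.

Lemma dmapB f x u v : dmap f x (u - v) = dmap f x u - dmap f x v.
Proof. by rewrite dmap.unlock linearB. Qed.

Lemma dmapZ f x a v : dmap f x (a *: v) = a *: dmap f x v.
Proof. by rewrite dmap.unlock linearZ. Qed.

Lemma dmap0 f x : dmap f x 0 = 0.
Proof. by rewrite dmap.unlock linear0. Qed.

Lemma dmap_sum f x (I : Type) (r : seq I) (F : I -> vec) :
  dmap f x (\sum_(i <- r) F i) = \sum_(i <- r) dmap f x (F i).
Proof. by rewrite dmap.unlock linear_sum. Qed.

Lemma dmap_comp f g x v : differentiable f x -> differentiable g (f x) ->
  dmap (g \o f) x v = dmap g (f x) (dmap f x v).
Proof.
move=> df dg; rewrite dmap.unlock.
have /(congr1 (fun F : vec -> vec => F v)) H := diff_comp df dg.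
exact: H.
Qed.

Lemma dmap_id x v : dmap id x v = v.
Proof. by rewrite dmap.unlock diff_val. Qed.

Lemma near_eq_dmap f g x v : differentiable f x -> differentiable g x ->
  (\forall y \near x, f y = g y) -> dmap f x v = dmap g x v.
Proof.
move=> df dg fg; rewrite !dmapE.
exact: (etrans (esym (deriveE v df)) (etrans (near_eq_derive v fg) (deriveE v dg))).
Qed.

Lemma dmap_enorm_le f x v :
  enorm (dmap f x v) <= (\sum_(i < m) enorm (dmap f x (delta_mx 0 i))) * enorm v.
Proof.
rewrite {1}(row_sum_delta v) dmap_sum mulr_suml.
apply: le_trans (ler_enorm_sum _ _ _) _; apply: ler_sum => i _.
by rewrite dmapZ enormZ mulrC ler_wpM2l ?enorm_ge0// coord_le_enorm.
Qed.

(** [Ck] gives continuity of the differential on each fixed vector, so the basis vectors are bounded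
    one by one and their bounds added. *)
Lemma compact_dmap_le (A : set vec) f : compact A ->
  (forall w x, A x -> {for x, continuous (fun y => dmap f y w)}) ->
  exists2 K : R, 0 <= K & forall x u, A x -> enorm (dmap f x u) <= K * enorm u.
Proof.
move=> cA fA.
have /fin_all_exists2[K K0 HK] : forall i : 'I_m, exists2 K : R, 0 <= K &
    forall x, A x -> enorm (dmap f x (delta_mx 0 i)) <= K.
  by move=> i; apply: (compact_enorm_le cA); exact: fA.
exists (\sum_i K i); first exact: sumr_ge0.
move=> x u Ax; apply: le_trans (dmap_enorm_le f x u) _.
by rewrite ler_wpM2r ?enorm_ge0//; apply: ler_sum => i _; exact: HK.
Qed.

End Dmap.

(** * Regularity of the unstable direction *)

Section Dynamics.
Context {R : realType} {m : nat}.
Local Notation vec := 'rV[R]_m.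
Variables (M Lam : set vec) (phi phiV : vec -> vec).
Variables (Eu Es : vec -> {vspace vec}) (q : vec -> vec) (C lam : R).
Hypotheses (oM : open M) (dM : diffeo 3 M phi phiV).
Hypotheses (cLam : compact Lam) (LamM : Lam `<=` M) (phiLam : phi @` Lam = Lam).
Hypotheses (C0 : 0 < C) (lam01 : 0 < lam < 1).
Hypothesis hyp : hyperbolic_splitting phi phiV Lam Eu Es C lam.
Hypothesis uq : unstable_unit_field phi phiV Lam Eu q.

Local Notation alpha := (alpha phi phiV q).

Let lam_ge0 : 0 <= lam. Proof. by case/andP: lam01 => /ltW. Qed.

Lemma Lam_phi x : Lam x -> Lam (phi x).
Proof. by move=> Lx; rewrite -phiLam; exists x. Qed.

Lemma phiK x : Lam x -> phiV (phi x) = x.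
Proof. by case: dM => H _ _ _ /LamM /H[]. Qed.

Lemma phiVK x : Lam x -> phi (phiV x) = x.
Proof. by case: dM => _ H _ _ /LamM /H[]. Qed.

Lemma Lam_phiV x : Lam x -> Lam (phiV x).
Proof. by rewrite -[X in X x]phiLam => -[y Ly <-]; rewrite phiK. Qed.

Lemma Lam_iterV n x : Lam x -> Lam (iter n phiV x).
Proof. by move=> Lx; elim: n => //= n; exact: Lam_phiV. Qed.

Lemma Lam_iter n x : Lam x -> Lam (iter n phi x).
Proof. by move=> Lx; elim: n => //= n; exact: Lam_phi. Qed.

Lemma iter_phiVK n x : Lam x -> iter n phi (iter n phiV x) = x.
Proof.
elim: n x => //= n IH x Lx.
by rewrite -iterS iterSr (phiVK (Lam_iterV n Lx)) IH.
Qed.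

Lemma diff_phi x : Lam x -> differentiable phi x.
Proof. by case: dM => _ _ [H _] _ /LamM /H. Qed.

Lemma diff_phiV x : Lam x -> differentiable phiV x.
Proof. by case: dM => _ _ _ [H _] /LamM /H. Qed.

Lemma diff_iter n x : Lam x -> differentiable (iter n phi) x.
Proof.
move=> Lx; elim: n => [|n IH]; first exact: (@ex_diff _ _ _ _ _ id id).
by apply: (differentiable_comp IH); exact/diff_phi/Lam_iter.
Qed.

Lemma diff_iterV n x : Lam x -> differentiable (iter n phiV) x.
Proof.
move=> Lx; elim: n => [|n IH]; first exact: (@ex_diff _ _ _ _ _ id id).
by apply: (differentiable_comp IH); exact/diff_phiV/Lam_iterV.
Qed.

Lemma d_iterS n x v : Lam x ->
  dmap (iter n.+1 phi) x v = dmap phi (iter n phi x) (dmap (iter n phi) x v).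
Proof.
by move=> Lx; rewrite -dmap_comp//; [exact: diff_iter|exact/diff_phi/Lam_iter].
Qed.

Lemma d_iterSr n x v : Lam x ->
  dmap (iter n.+1 phi) x v = dmap (iter n phi) (phi x) (dmap phi x v).
Proof.
move=> Lx; rewrite -dmap_comp; [|exact: diff_phi|exact/diff_iter/Lam_phi].
by congr dmap; apply/funext => y; rewrite iterSr.
Qed.

Lemma d_iterVS n x v : Lam x ->
  dmap (iter n.+1 phiV) x v = dmap phiV (iter n phiV x) (dmap (iter n phiV) x v).
Proof.
by move=> Lx; rewrite -dmap_comp//; [exact: diff_iterV|exact/diff_phiV/Lam_iterV].
Qed.

Lemma d_iter0 x v : dmap (iter 0 phi) x v = v.
Proof. exact: dmap_id. Qed.

Lemma d_iterV0 x v : dmap (iter 0 phiV) x v = v.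
Proof. exact: dmap_id. Qed.

(** [phiV \o phi] is known to be the identity on [M] only; since [M] is open, this holds near [x],
    which is all that the differential sees. *)
Lemma dphiK x v : Lam x -> dmap phiV (phi x) (dmap phi x v) = v.
Proof.
move=> Lx; rewrite -dmap_comp; [|exact: diff_phi|exact/diff_phiV/Lam_phi].
rewrite -[RHS](dmap_id x); apply: near_eq_dmap.
- by apply: differentiable_comp; [exact: diff_phi|exact/diff_phiV/Lam_phi].
- exact: (@ex_diff _ _ _ _ _ id id).
have : \forall y \near x, M y by apply: open_nbhs_nbhs; split => //; exact: LamM.
by apply: filterS => y My /=; case: dM => H _ _ _; have [] := H y My.
Qed.

Lemma dphi_Eu x v : Lam x -> v \in Eu x -> dmap phi x v \in Eu (phi x).
Proof.
move=> Lx vE; have [_ _ [H _] _ _] := hyp Lx.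
rewrite dmapE; suff : [set` Eu (phi x)] ('d phi x v) by [].
by rewrite -H; exists v.
Qed.

Lemma dphi_Es x v : Lam x -> v \in Es x -> dmap phi x v \in Es (phi x).
Proof.
move=> Lx vE; have [_ _ [_ H] _ _] := hyp Lx.
rewrite dmapE; suff : [set` Es (phi x)] ('d phi x v) by [].
by rewrite -H; exists v.
Qed.

Lemma q_Eu x : Lam x -> q x \in Eu x.
Proof. by move=> /uq[]. Qed.

Lemma enorm_q x : Lam x -> enorm (q x) = 1.
Proof. by move=> /uq[]. Qed.

Lemma dot_qq x : Lam x -> dot (q x) (q x) = 1.
Proof. by move=> Lx; rewrite -sqr_enorm enorm_q// expr1n. Qed.

Lemma q_neq0 x : Lam x -> q x != 0.
Proof.
move=> Lx; apply/eqP => q0; have := enorm_q Lx; rewrite q0 enorm0 => /eqP.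
by rewrite eq_sym oner_eq0.
Qed.

Lemma dphi_q x : Lam x -> dmap phi x (q x) = alpha (phi x) *: q (phi x).
Proof. by rewrite dmapE => /uq[]. Qed.

Lemma alpha_gt0 x : Lam x -> 0 < alpha x.
Proof.
move=> Lx; rewrite lt_def enorm_ge0 andbT; apply/eqP => a0.
have Ly := Lam_phiV Lx; have := dphi_q Ly; rewrite phiVK// a0 scale0r => q0.
have := dphiK (q (phiV x)) Ly; rewrite q0 dmap0 => /esym/eqP.
by apply/negP; exact: q_neq0.
Qed.

Lemma dphiV_q x : Lam x -> dmap phiV x (q x) = (alpha x)^-1 *: q (phiV x).
Proof.
move=> Lx; have Ly := Lam_phiV Lx.
have := dphiK (q (phiV x)) Ly; rewrite dphi_q// phiVK// dmapZ => <-.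
by rewrite scalerA mulVf ?scale1r// gt_eqF// alpha_gt0.
Qed.

Lemma Eu_q x v : Lam x -> v \in Eu x -> v = dot v (q x) *: q x.
Proof.
move=> Lx vE; have [_ [d1 _] _ _ _] := hyp Lx.
have Eq : (Eu x = <[q x]>)%VS.
  apply/esym/eqP; rewrite eqEdim d1 dim_vline q_neq0// andbT.
  by rewrite -memvE q_Eu.
move: vE; rewrite Eq => /vlineP[c ->].
by rewrite dotZl dot_qq// mulr1.
Qed.

(** * Contraction of [q] backward in time, and the stable projection *)

(** The reciprocal of the product of [alpha] over the first [n] points of the backward orbit,
    starting with [x] itself: the factor by which the differential of the [n]-th backward iterate
    scales [q x]. *)
Fixpoint gamma n x : R :=
  if n is n'.+1 then gamma n' x / alpha (iter n' phiV x) else 1.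

Lemma gamma_gt0 n x : Lam x -> 0 < gamma n x.
Proof. by move=> Lx; elim: n => //= n IH; rewrite divr_gt0// alpha_gt0//; exact: Lam_iterV. Qed.

Lemma d_iterV_q n x : Lam x ->
  dmap (iter n phiV) x (q x) = gamma n x *: q (iter n phiV x).
Proof.
move=> Lx; elim: n => [|n IH]; first by rewrite d_iterV0 scale1r.
by rewrite d_iterVS// IH dmapZ dphiV_q ?scalerA//; exact: Lam_iterV.
Qed.

Lemma gamma_le n x : Lam x -> gamma n x <= C * lam ^+ n.
Proof.
move=> Lx; have [_ _ _ H _] := hyp Lx.
have /H/(_ n) := q_Eu Lx; rewrite -dmapE d_iterV_q// enormZ !enorm_q ?mulr1//;
  last exact: Lam_iterV.
exact/le_trans/ler_norm.
Qed.

Lemma enorm_d_iter_Es n x v : Lam x -> v \in Es x ->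
  enorm (dmap (iter n phi) x v) <= C * lam ^+ n * enorm v.
Proof. by move=> Lx vE; have [_ _ _ _ /(_ v)[H _]] := hyp Lx; rewrite dmapE; exact: H. Qed.

Definition pi x (v : vec) := daddv_pi (Es x) (Eu x) v.

Lemma piD x u v : pi x (u + v) = pi x u + pi x v.
Proof. by rewrite /pi linearD. Qed.

Lemma piZ x a v : pi x (a *: v) = a *: pi x v.
Proof. by rewrite /pi linearZ. Qed.

Lemma piB x u v : pi x (u - v) = pi x u - pi x v.
Proof. by rewrite /pi linearB. Qed.

Let cap0 x : Lam x -> (Es x :&: Eu x)%VS = 0%VS.
Proof. by move=> Lx; have [[_ H] _ _ _ _] := hyp Lx; rewrite capvC. Qed.

Lemma pi_Es x v : pi x v \in Es x.
Proof. exact: memv_pi. Qed.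

Lemma pi_id x v : Lam x -> v \in Es x -> pi x v = v.
Proof. by move=> Lx vE; apply: daddv_pi_id => //; exact: cap0. Qed.

Lemma pi_split x v : Lam x -> v - pi x v \in Eu x.
Proof.
move=> Lx; have [[H _] _ _ _ _] := hyp Lx.
have : v \in (Es x + Eu x)%VS by rewrite addvC H memvf.
move/(daddv_pi_add (cap0 Lx)) => {1}<-.
by rewrite addrAC subrr add0r memv_pi.
Qed.

Lemma pi_Eu x v : Lam x -> v \in Eu x -> pi x v = 0.
Proof.
move=> Lx vE; apply/eqP; rewrite -memv0 -(cap0 Lx) memv_cap pi_Es/=.
by rewrite -[pi x v](subKr v) rpredB// pi_split.
Qed.

Lemma pi_q x : Lam x -> pi x (q x) = 0.
Proof. by move=> Lx; rewrite pi_Eu// q_Eu. Qed.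

Lemma pi_dphi x v : Lam x -> pi (phi x) (dmap phi x v) = dmap phi x (pi x v).
Proof.
move=> Lx; have Ly := Lam_phi Lx.
rewrite -{1}(subrK (pi x v) v) dmapD piD pi_Eu//; last first.
  by apply: dphi_Eu => //; exact: pi_split.
by rewrite add0r pi_id//; apply: dphi_Es => //; exact: pi_Es.
Qed.

Lemma gammaSr n x : gamma n.+1 x = gamma n (phiV x) / alpha x.
Proof.
elim: n => [//|n IH].
by rewrite -[LHS]/(gamma n.+1 x / alpha (iter n.+1 phiV x)) IH mulrAC iterSr.
Qed.

Lemma d_iter_q n x : Lam x ->
  dmap (iter n phi) x (q x) = (gamma n (iter n phi x))^-1 *: q (iter n phi x).
Proof.
move=> Lx; elim: n => [|n IH]; first by rewrite d_iter0 invr1 scale1r.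
have Ly := Lam_iter n Lx.
rewrite d_iterS// IH dmapZ dphi_q// scalerA -[iter n.+1 phi x]/(phi (iter n phi x)).
by rewrite gammaSr phiK// invfM invrK.
Qed.

Let cont_dphi w x : Lam x -> {for x, continuous (fun y => dmap phi y w)}.
Proof.
move=> /LamM Mx; case: dM => _ _ [_ /(_ w)[H _]] _.
by rewrite dmap.unlock; apply: differentiable_continuous; exact: H.
Qed.

Lemma dphi_bound : exists2 L : R, 0 <= L &
  forall x v, Lam x -> enorm (dmap phi x v) <= L * enorm v.
Proof. by apply: compact_dmap_le => // w x; exact: cont_dphi. Qed.

Lemma geo_small (e : R) : 0 < e -> exists n, lam ^+ n < e.
Proof.
move=> e0; case/andP: lam01 => l0 l1.
have /cvgr0Pnorm_lt/(_ _ e0)[n _ /(_ n (leqnn n))] : lam ^+ n @[n --> \oo] --> (0 : R).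
  by apply: cvg_expr; rewrite ger0_norm.
by exists n; rewrite (le_lt_trans (ler_norm _)).
Qed.

Lemma enorm_d_iter n L x v : 0 <= L ->
  (forall x v, Lam x -> enorm (dmap phi x v) <= L * enorm v) -> Lam x ->
  enorm (dmap (iter n phi) x v) <= L ^+ n * enorm v.
Proof.
move=> L0 HL Lx; elim: n => [|n IH]; first by rewrite d_iter0 mul1r.
rewrite d_iterS// (le_trans (HL _ _ (Lam_iter n Lx)))// exprS -mulrA.
by rewrite ler_wpM2l.
Qed.

(* For large [n], [dphi^n] expands the [Eu] part of [v] and contracts its [Es]
   part, so neither part can be much larger than [v]. *)
Lemma pi_bound : exists2 K : R, 0 <= K & forall x v, Lam x -> enorm (pi x v) <= K * enorm v.
Proof.
have [L L0 HL] := dphi_bound.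
(* Chosen so that [g * g <= 2^-1] below: the bounds of [c] through [s] and of [s] through [c] then
   close up. *)
have C2 : 0 < (2 * C * C)^-1 by rewrite invr_gt0 !mulr_gt0.
have [n Hn] := geo_small C2.
case/andP: (lam01) => l0 l1.
set g := C * lam ^+ n; have g0 : 0 < g by rewrite mulr_gt0// exprn_gt0.
have gg : g * g <= 2^-1.
  have ln1 : lam ^+ n <= 1 by rewrite exprn_ile1// ltW.
  have Hn' : C * C * lam ^+ n <= 2^-1.
    have : lam ^+ n * (2 * C * C) < 1 by rewrite -ltr_pdivlMr ?div1r// !mulr_gt0.
    lra.
  apply: le_trans Hn'; rewrite /g mulrACA; apply: ler_wpM2l.
    by rewrite mulr_ge0// ltW.
  by rewrite ler_piMr// exprn_ge0// ltW.
(* With [V] and [S] the norms of [v] and [s], this solves [|c| <= g L^n V + (V + |c|) / 2] together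
   with [S <= V + |c|]. *)
exists (1 + 2 * (g * L ^+ n + 2^-1)).
  by rewrite addr_ge0// mulr_ge0// addr_ge0// mulr_ge0 ?exprn_ge0// ltW.
move=> x v Lx; set s := pi x v; set c := dot (v - s) (q x).
have vs : v - s = c *: q x by apply: Eu_q => //; exact: pi_split.
have s_le : enorm s <= enorm v + `|c|.
  rewrite -[s](subKr v) vs (le_trans (ler_enormD _ _))//.
  by rewrite enormN enormZ enorm_q// mulr1.
have c_le : `|c| <= g * (L ^+ n * enorm v + g * enorm s).
  have Ly := Lam_iter n Lx.
  have := gamma_le n Ly; rewrite -/g => gam.
  have gam0 := gamma_gt0 n Ly.
  have E : c *: q (iter n phi x) = gamma n (iter n phi x) *:
      (dmap (iter n phi) x v - dmap (iter n phi) x s).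
    rewrite -dmapB vs dmapZ d_iter_q// !scalerA; congr (_ *: _).
    by field; rewrite gt_eqF.
  have -> : `|c| = enorm (c *: q (iter n phi x)) by rewrite enormZ enorm_q// mulr1.
  rewrite E enormZ gtr0_norm//; apply: ler_pM => //; [exact: ltW|exact: enorm_ge0|].
  apply: le_trans (ler_enormD _ _) _; rewrite enormN; apply: lerD.
    exact: enorm_d_iter.
  by apply: enorm_d_iter_Es => //; exact: pi_Es.
have := normr_ge0 c; have := enorm_ge0 v; move: c_le s_le gg g0.
move: (enorm v) (enorm s) `|c| (L ^+ n) => V S c' Ln.
rewrite mulrDr mulrA (mulrA g g) => H1 H2 H3 H4 H5 H7.
have H6 : g * g * S <= 2^-1 * (V + c').
  apply: (@le_trans _ _ (g * g * (V + c'))); first by rewrite ler_wpM2l// mulr_ge0// ltW.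
  by apply: ler_wpM2r => //; rewrite addr_ge0.
lra.
Qed.

(* Expanding over the basis makes linearity in [v] definitional. *)
Definition d2 x (u v : vec) : vec :=
  \sum_(i < m) v 0 i *: dmap (fun y => dmap phi y (delta_mx 0 i)) x u.

Lemma d2_bound : exists2 K : R, 0 <= K &
  forall x u v, Lam x -> enorm (d2 x u v) <= K * enorm u * enorm v.
Proof.
have /fin_all_exists2[K K0 HK] : forall i : 'I_m, exists2 K : R, 0 <= K &
    forall x u, Lam x -> enorm (dmap (fun y => dmap phi y (delta_mx 0 i)) x u)
      <= K * enorm u.
  move=> i; apply: (compact_dmap_le cLam) => w x /LamM Mx.
  case: dM => _ _ [_ /(_ (delta_mx 0 i))[_ /(_ w)[H _]]] _.
  by rewrite dmap.unlock; apply: differentiable_continuous; exact: H.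
exists (\sum_i K i); first exact: sumr_ge0.
move=> x u v Lx; rewrite /d2; apply: le_trans (ler_enorm_sum _ _ _) _.
rewrite !mulr_suml; apply: ler_sum => i _; rewrite enormZ mulrC.
by apply: ler_pM; rewrite ?enorm_ge0 ?HK// coord_le_enorm.
Qed.

Lemma derive_within_dphi (A : set R) (c w : R -> vec) t l k : Lam (c t) ->
  is_derive_within A c t l -> is_derive_within A w t k ->
  is_derive_within A (fun s => dmap phi (c s) (w s)) t
    (dmap phi (c t) k + d2 (c t) l (w t)).
Proof.
move=> Lc cl wk.
have E x v : dmap phi x v = \sum_(i < m) v 0 i *: dmap phi x (delta_mx 0 i).
  rewrite {1}(row_sum_delta v) dmap_sum; apply: eq_bigr => i _.
  by rewrite dmapZ.
under eq_fun do rewrite E.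
rewrite addrC (E _ k) /d2 -big_split/=; apply: derive_within_sum => i.
apply: derive_withinZ; first exact: derive_within_coord.
have := @derive_within_diff _ _ _ (fun y => dmap phi y (delta_mx 0 i)) c A t l.
rewrite -dmapE; apply => //.
case: dM => _ _ [_ /(_ (delta_mx 0 i))[H _]] _.
by rewrite dmap.unlock; apply: H; exact: LamM.
Qed.

(** * Curves tangent to [q], and Lipschitz estimates for [q] along them *)

(** No regularity is asked of the speed [beta]: taking backward images multiplies it by [gamma],
    whose continuity rests on that of [q], still unknown here. Only the bound [B] is carried
    along. *)
Definition ucurve (A : set R) (c : R -> vec) (beta : R -> R) (B : R) : Prop :=
  is_interval A /\ forall s, A s ->
  [/\ Lam (c s), is_derive_within A c s (beta s *: q (c s)) & `|beta s| <= B].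

Lemma ucurve_iterV n A c beta B : ucurve A c beta B ->
  ucurve A (fun s => iter n phiV (c s)) (fun s => beta s * gamma n (c s))
    (B * (C * lam ^+ n)).
Proof.
move=> [iA cA]; split=> // s As; have [Lc dc bB] := cA s As.
split; first exact: Lam_iterV.
  rewrite -scalerA -(d_iterV_q n Lc) -dmapZ dmapE.
  exact: (derive_within_diff (diff_iterV n Lc) dc).
rewrite normrM; apply: ler_pM => //.
by rewrite (gtr0_norm (gamma_gt0 _ _))// gamma_le.
Qed.

Lemma ucurve_lipschitz A c beta B s t : ucurve A c beta B -> A s -> A t ->
  enorm (c s - c t) <= B * `|s - t|.
Proof.
move=> [iA cA] As At.
apply: (@derive_within_lipschitz _ _ A c (fun s => beta s *: q (c s))) => // u Au;
  have [Lc dc bB] := cA u Au => //.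
by rewrite enormZ enorm_q// mulr1.
Qed.

(** Both differentials act on the same vector, so the term measures only the change of base point of
    [dphi] at backward time [k + 1]; it is projected to [Es] and carried forward [k] steps. *)
Definition q_term k y z : vec :=
  gamma k.+1 y *: dmap (iter k phi) (iter k phiV z) (pi (iter k phiV z)
    (dmap phi (iter k.+1 phiV y) (q (iter k.+1 phiV y))
     - dmap phi (iter k.+1 phiV z) (q (iter k.+1 phiV y)))).

(* The projection onto [Es] along [Eu], applied to [dphi q = alpha q] and iterated:
   no regularity of [q] enters. *)
Lemma q_expansion N y z : Lam y -> Lam z ->
  pi z (q y) = gamma N y *: dmap (iter N phi) (iter N phiV z)
                 (pi (iter N phiV z) (q (iter N phiV y)))
               + \sum_(k < N) q_term k y z.
Proof.
move=> Ly Lz; elim: N => [|N IH]; first by rewrite big_ord0 addr0 d_iter0 scale1r.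
rewrite IH [LHS]addrC big_ord_recr/= addrCA; congr (_ + _).
set yN := iter N phiV y; set zN := iter N phiV z.
have LyN : Lam yN by exact: Lam_iterV.
have LzN : Lam zN by exact: Lam_iterV.
rewrite /q_term /= -/zN -/yN.
have LzV := Lam_phiV LzN; have LyV := Lam_phiV LyN.
rewrite d_iterSr// phiVK// -scalerDr -dmapD -pi_dphi// phiVK// -piD addrC subrK.
rewrite dphi_q// phiVK// piZ dmapZ scalerA; congr (_ *: _).
by rewrite -/yN mulrAC -mulrA divff ?mulr1// gt_eqF// alpha_gt0.
Qed.

Lemma le_geo (a b X : R) : 0 <= X -> (forall n, a <= b + X * lam ^+ n) -> a <= b.
Proof.
move=> X0 H; apply/ler_addgt0Pr => e e0.
have [n Hn] := geo_small (divr_gt0 e0 (ltr_wpDl X0 ltr01)).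
apply: le_trans (H n) _; rewrite lerD2l.
apply: le_trans (_ : (X + 1) * lam ^+ n <= _).
  by rewrite ler_wpM2r ?exprn_ge0// lerDl.
by rewrite mulrC -ler_pdivlMr ?ltW// ltr_wpDl.
Qed.

Lemma geo_sum_le n : \sum_(k < n) lam ^+ k <= (1 - lam)^-1.
Proof.
case/andP: lam01 => l0 l1; have l1' : 0 < 1 - lam by rewrite subr_gt0.
rewrite -(ler_pM2l l1') mulfV ?gt_eqF// -opprB mulNr -subrX1 opprB lerBlDl lerDr.
exact: exprn_ge0.
Qed.

Lemma q_remainder_le K N y z : 0 <= K ->
  (forall x v, Lam x -> enorm (pi x v) <= K * enorm v) -> Lam y -> Lam z ->
  enorm (gamma N y *: dmap (iter N phi) (iter N phiV z)
                 (pi (iter N phiV z) (q (iter N phiV y)))) <=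
  gamma N y * (C * K * lam ^+ N).
Proof.
move=> K0 HK Ly Lz; rewrite enormZ gtr0_norm ?gamma_gt0// ler_wpM2l ?(ltW (gamma_gt0 _ _))//.
have LzN := Lam_iterV N Lz; have LyN := Lam_iterV N Ly.
apply: le_trans (enorm_d_iter_Es _ _ (pi_Es _ _)) _ => //.
rewrite mulrAC ler_wpM2r ?exprn_ge0// ler_wpM2l ?(ltW C0)//.
by rewrite (le_trans (HK _ _ _))// enorm_q// mulr1.
Qed.

(** The estimate runs along the curve: [d2] is bounded on [Lam], which need not contain the segment
    from [c t] to [c s]. *)
Lemma dphi_lipschitz_ucurve K A c beta B s t w : 0 <= K ->
  (forall x u v, Lam x -> enorm (d2 x u v) <= K * enorm u * enorm v) ->
  ucurve A c beta B -> A s -> A t ->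
  enorm (dmap phi (c s) w - dmap phi (c t) w) <= K * B * enorm w * `|s - t|.
Proof.
move=> K0 HK [iA cA] As At.
apply: (@derive_within_lipschitz _ _ A (fun u => dmap phi (c u) w)
   (fun u => d2 (c u) (beta u *: q (c u)) w)) => // u Au;
  have [Lc dc bB] := cA u Au.
  have := derive_within_dphi Lc dc (derive_within_cst A w u).
  by rewrite dmap0 add0r.
apply: le_trans (HK _ _ _ Lc) _; rewrite ler_wpM2r ?enorm_ge0// ler_wpM2l//.
by rewrite enormZ enorm_q// mulr1.
Qed.

(** One [K] serves all curves. The estimate can thus be applied again to backward images of a curve,
    where the speed bound is smaller. *)
Lemma pi_q_lipschitz : exists2 K : R, 0 <= K & forall A c beta B s t,
  ucurve A c beta B -> A s -> A t -> enorm (pi (c t) (q (c s))) <= K * B * `|s - t|.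
Proof.
have [Kp Kp0 HKp] := pi_bound; have [K2 K20 HK2] := d2_bound.
case/andP: (lam01) => l0 l1.
have lk1 k : lam ^+ k <= 1 by rewrite exprn_ile1// ltW.
(* The factors bound, in turn, [gamma], [dphi^k] on [Es] (its [lam ^+ k] is kept for the sum), the
   projection, and the change of [dphi] along a backward curve of speed at most [B * C]. *)
pose K1 := C * C * Kp * K2 * C.
have K10 : 0 <= K1 by rewrite !mulr_ge0// ltW.
exists (K1 * (1 - lam)^-1); first by rewrite mulr_ge0// invr_ge0 subr_ge0 ltW.
move=> A c beta B s t cu As At; have [_ cA] := cu.
have [Ls _ bB] := cA s As; have [Lt _ _] := cA t At.
have B0 : 0 <= B by exact: le_trans bB.
apply: (@le_geo _ _ (C * (C * Kp))) => [|N].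
  by rewrite !mulr_ge0// ltW.
rewrite (q_expansion N Ls Lt) addrC; apply: le_trans (ler_enormD _ _) _.
apply: lerD; last first.
  apply: le_trans (q_remainder_le N Kp0 HKp Ls Lt) _.
  rewrite -[leRHS]mulrA; apply: ler_pM => //.
  - exact/ltW/gamma_gt0.
  - by rewrite !mulr_ge0 ?exprn_ge0// ltW.
  - by rewrite (le_trans (gamma_le _ _))// ler_piMr// ltW.
apply: le_trans (ler_enorm_sum _ _ _) _.
apply: (@le_trans _ _ (\sum_(k < N) K1 * B * `|s - t| * lam ^+ k)); last first.
  have -> : K1 * (1 - lam)^-1 * B * `|s - t| = K1 * B * `|s - t| * (1 - lam)^-1 by ring.
  rewrite -mulr_sumr; apply: ler_wpM2l (geo_sum_le N).
  by apply: mulr_ge0 => //; exact: mulr_ge0.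
apply: ler_sum => k _; rewrite /q_term enormZ gtr0_norm ?gamma_gt0//.
have LtN := Lam_iterV k Lt; have LsN := Lam_iterV k.+1 Ls.
have := dphi_lipschitz_ucurve (q (iter k.+1 phiV (c s))) K20 HK2 (ucurve_iterV k.+1 cu) As At.
set D := dmap phi _ _ - _ => HD.
have {}HD : enorm D <= K2 * B * C * `|s - t|.
  apply: le_trans HD _; rewrite ler_wpM2r// enorm_q// mulr1 -mulrA ler_wpM2l//.
  by rewrite ler_wpM2l// ler_piMr// ltW.
have H1 : gamma k.+1 (c s) <= C.
  by rewrite (le_trans (gamma_le _ _))// ler_piMr// ltW.
have H2 : enorm (dmap (iter k phi) (iter k phiV (c t)) (pi (iter k phiV (c t)) D)) <=
    C * lam ^+ k * (Kp * (K2 * B * C * `|s - t|)).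
  apply: le_trans (enorm_d_iter_Es _ _ (pi_Es _ _)) _ => //.
  rewrite ler_wpM2l ?mulr_ge0 ?exprn_ge0// ?(ltW C0)//.
  by rewrite (le_trans (HKp _ _ _))// ler_wpM2l.
apply: le_trans (_ : _ <= C * (C * lam ^+ k * (Kp * (K2 * B * C * `|s - t|)))) _.
  by apply: ler_pM => //; [exact/ltW/gamma_gt0|exact: enorm_ge0].
by rewrite le_eqVlt; apply/orP; left; apply/eqP; rewrite /K1; ring.
Qed.

(** If the product were zero, both parts of [q y] in the splitting at [z] would have norm at most
    that of [pi z (q y)], and [q y] would be shorter than 1. *)
Lemma dot_q_neq0 y z : Lam y -> Lam z -> enorm (pi z (q y)) < 2^-1 ->
  dot (q y) (q z) != 0.
Proof.
move=> Ly Lz; set e := pi z (q y) => He.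
have E : q y = e + dot (q y - e) (q z) *: q z.
  by rewrite -(Eu_q Lz (pi_split (q y) Lz)) addrC subrK.
have := ler_enormD e (dot (q y - e) (q z) *: q z).
rewrite -E enorm_q// enormZ enorm_q// mulr1 dotBl.
have := ler_dot_enorm e (q z); rewrite enorm_q// mulr1 => H1 H2.
by apply/eqP => d0; move: H2; rewrite d0 sub0r normrN; lra.
Qed.

(* After enough backward iterates the curve is nearly straight, so by Rolle it
   cannot close up. *)
Lemma ucurve_no_return A c beta B s t : ucurve A c beta B ->
  (forall u, A u -> 0 < beta u) -> A s -> A t -> s < t -> c s <> c t.
Proof.
move=> cu beta0 As At st cst; have [K K0 HK] := pi_q_lipschitz.
have [iA cA] := cu; have [Ls _ bB] := cA s As.
have B0 : 0 <= B by exact: le_trans bB.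
pose X := K * (B * C) * (t - s).
have X0 : 0 <= X by rewrite !mulr_ge0// ?subr_ge0 ltW.
have h0 : (0 : R) < 2^-1 by rewrite invr_gt0.
have [n Hn] := geo_small (divr_gt0 h0 (ltr_wpDl X0 ltr01)).
have cun := ucurve_iterV n cu; have [_ cnA] := cun.
set z := iter n phiV (c s); have Lz : Lam z by exact: Lam_iterV.
have dh u : A u -> is_derive_within A (fun u => dot (iter n phiV (c u)) (q z)) u
    (beta u * gamma n (c u) * dot (q (iter n phiV (c u))) (q z)).
  move=> Au; have [_ dc _] := cnA u Au.
  have := derive_within_dot dc (derive_within_cst A (q z) u).
  by rewrite (dotC _ 0) dot0l add0r dotZl.
have [u [Au su ut]] := derive_within_mvt iA dh As At st.
rewrite /= -cst subrr => /esym/eqP.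
have [Lu _ _] := cA u Au.
rewrite mulf_eq0 subr_eq0 (gt_eqF st) orbF mulf_eq0 gt_eqF/=; last first.
  by rewrite mulr_gt0 ?beta0 ?gamma_gt0.
apply/negP; apply: dot_q_neq0 => //; first exact: Lam_iterV.
apply: le_lt_trans (HK _ _ _ _ _ _ cun Au As) _.
apply: (@le_lt_trans _ _ (X * lam ^+ n)).
  rewrite gtr0_norm ?subr_gt0//.
  apply: (@le_trans _ _ (K * (B * (C * lam ^+ n)) * (t - s))).
    rewrite ler_wpM2l ?lerD2r ?(ltW ut)//.
    by rewrite !mulr_ge0 ?exprn_ge0// ltW.
  by rewrite le_eqVlt; apply/orP; left; apply/eqP; rewrite /X; ring.
apply: (@le_lt_trans _ _ ((X + 1) * lam ^+ n)).
  by rewrite ler_wpM2r ?exprn_ge0// lerDl.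
by rewrite mulrC -ltr_pdivlMr// ltr_wpDl.
Qed.

(** For unit vectors, [dot (q y - q z) (q z)] is minus half the squared distance. The difference is
    therefore linear in [e] up to a term of second order. *)
Lemma q_diffE y z : Lam y -> Lam z -> let e := pi z (q y) in
  q y - q z = e - dot e (q z) *: q z - (enorm (q y - q z) ^+ 2 / 2) *: q z.
Proof.
move=> Ly Lz e; have E := Eu_q Lz (pi_split (q y) Lz).
rewrite sqr_enorm; set D := q y - q z.
have DD : dot D D = 2 - 2 * dot (q y) (q z).
  by rewrite /D dotBl !dotBr !dot_qq// (dotC (q z)); lra.
rewrite DD /D -{1}(subrK (pi z (q y)) (q y)) E -/e dotBl.
by apply/rowP => i; rewrite !mxE; lra.
Qed.

(** The positive product excludes [q y] close to [- q z], where [pi z (q y)] is small as well. It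
    makes the coefficient [d] of [q z] positive, and then [|d - 1|] is at most the norm of [e]. *)
Lemma dist_q_le y z : Lam y -> Lam z -> enorm (pi z (q y)) < 2^-1 ->
  0 < dot (q y) (q z) -> enorm (q y - q z) <= 2 * enorm (pi z (q y)).
Proof.
move=> Ly Lz He d0; set e := pi z (q y) in He *.
have E : q y = e + dot (q y - e) (q z) *: q z.
  by rewrite -(Eu_q Lz (pi_split (q y) Lz)) addrC subrK.
set d := dot (q y - e) (q z) in E.
have de : d = dot (q y) (q z) - dot e (q z) by rewrite /d dotBl.
have H1 := ler_enormD e (d *: q z).
have H2 := ler_enormD (q y) (- e).
have E2 : q y - e = d *: q z by rewrite {1}E addrAC subrr add0r.
rewrite -E enorm_q// enormZ enorm_q// mulr1 in H1.
rewrite E2 enormN enormZ !enorm_q// mulr1 in H2.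
have H3 := ler_dot_enorm e (q z); rewrite enorm_q// mulr1 in H3.
have dpos : 0 < d.
  rewrite ltNge; apply/negP => dn; move: H1 H3; rewrite (ler0_norm dn) ler_norml.
  by move=> H1 /andP[_ H3]; lra.
rewrite (gtr0_norm dpos) in H1 H2.
have -> : q y - q z = e + (d - 1) *: q z.
  by rewrite {1}E scalerBl scale1r addrA.
apply: le_trans (ler_enormD _ _) _; rewrite enormZ enorm_q// mulr1.
have : `|d - 1| <= enorm e by rewrite ler_norml; lra.
lra.
Qed.

(** A sign jump of [q] is excluded here: [beta u * dot (q (c u)) (q (c t))] is the derivative of
    [dot (c u) (q (c t))] and does not vanish for [u] close to [t], so it keeps its positive sign at
    [t]. *)
Lemma dist_q_ucurve_le : exists2 K : R, 0 <= K & forall A c beta B s t,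
  ucurve A c beta B -> (forall u, A u -> 0 < beta u) -> A s -> A t ->
  K * B * `|s - t| < 1 -> enorm (q (c s) - q (c t)) <= K * B * `|s - t|.
Proof.
have [K K0 HK] := pi_q_lipschitz; exists (2 * K); first exact: mulr_ge0.
move=> A c beta B s t cu beta0 As At; rewrite -!mulrA => st.
have [iA cA] := cu; have [Lt _ bB] := cA t At; have [Ls _ _] := cA s As.
have B0 : 0 <= B by exact: le_trans bB.
(* Every [u] in this window inherits the smallness assumed of [s], and the window is still an
   interval. *)
pose I := [set u | A u /\ `|u - t| <= `|s - t|].
have iI : is_interval I.
  move=> x y [Ax xt] [Ay yt] z /andP[xz zy]; split.
    by apply: (iA x y) => //; rewrite xz.
  by move: xt yt; rewrite !ler_norml => /andP[? _] /andP[_ ?]; apply/andP; split; lra.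
have IA : I `<=` A by move=> u [].
have small u : I u -> enorm (pi (c t) (q (c u))) < 2^-1.
  move=> [Au ut]; apply: le_lt_trans (HK _ _ _ _ _ _ cu Au At) _.
  apply: (@le_lt_trans _ _ (K * (B * `|s - t|))).
    by rewrite -mulrA ler_wpM2l// ler_wpM2l.
  lra.
have It : I t by split; rewrite ?subrr ?normr0.
have Is : I s by split.
have dh u : I u -> is_derive_within I (fun u => dot (c u) (q (c t))) u
    (beta u * dot (q (c u)) (q (c t))).
  move=> Iu; have [_ dc _] := cA u (IA u Iu); apply: (derive_withinS IA).
  have := derive_within_dot dc (derive_within_cst A (q (c t)) u).
  by rewrite (dotC _ 0) dot0l add0r dotZl.
have h0 u : I u -> beta u * dot (q (c u)) (q (c t)) != 0.
  move=> Iu; have [Lu _ _] := cA u (IA u Iu).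
  apply: mulf_neq0; first by rewrite gt_eqF// beta0//; exact: IA.
  by apply: dot_q_neq0 => //; exact: small.
have := derive_within_sign iI dh h0 It Is.
rewrite dot_qq// mulr1 beta0// => /(_ isT); rewrite pmulr_rgt0 ?beta0// => dpos.
apply: le_trans (dist_q_le Ls Lt (small s Is) dpos) _.
by rewrite ler_pM2l// mulrA; exact: (HK _ _ _ _ _ _ cu As At).
Qed.

(** * Differentiability of [q] along unstable curves *)

Lemma cvg_lipschitz (T : Type) (F : set_system T) (FF : Filter F)
    (L : vec -> vec) (K : R) (w : T -> vec) w0 :
  (forall u v, enorm (L u - L v) <= K * enorm (u - v)) ->
  w @ F --> w0 -> L (w s) @[s --> F] --> L w0.
Proof.
move=> LK ww0.
have H : K * enorm (w0 - w s) @[s --> F] --> K * enorm (w0 - w0).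
  by apply: cvgM; [exact: cvg_cst|apply: cvg_enorm; apply: cvgB => //; exact: cvg_cst].
rewrite subrr enorm0 mulr0 in H.
apply/cvgrPdist_le => e e0; near=> s.
apply: le_trans (norm_le_enorm _) _; apply: le_trans (LK _ _) _.
apply: le_trans (ler_norm _) _; near: s.
by move/cvgr0Pnorm_le: H; apply.
Unshelve. all: by end_near. Qed.

Lemma cvg_dmap f x (T : Type) (F : set_system T) (FF : Filter F) (w : T -> vec) w0 :
  w @ F --> w0 -> dmap f x (w s) @[s --> F] --> dmap f x w0.
Proof. by apply: cvg_lipschitz => u v; rewrite -dmapB; exact: dmap_enorm_le. Qed.

Lemma cvg_pi x (T : Type) (F : set_system T) (FF : Filter F) (w : T -> vec) w0 :
  Lam x -> w @ F --> w0 -> pi x (w s) @[s --> F] --> pi x w0.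
Proof.
move=> Lx; have [K _ HK] := pi_bound.
by apply: (@cvg_lipschitz _ _ _ _ K) => u v; rewrite -piB; exact: HK.
Qed.

Lemma cvg_dphi (T : Type) (F : set_system T) (FF : Filter F) (c w : T -> vec) z w0 :
  Lam z -> c @ F --> z -> w @ F --> w0 ->
  dmap phi (c s) (w s) @[s --> F] --> dmap phi z w0.
Proof.
move=> Lz cz ww0.
have E x v : dmap phi x v = \sum_(i < m) v 0 i *: dmap phi x (delta_mx 0 i).
  rewrite {1}(row_sum_delta v) dmap_sum; apply: eq_bigr => i _.
  by rewrite dmapZ.
under eq_fun do rewrite E.
rewrite E; apply: cvg_big => [|i _]; first exact: add_continuous.
apply: cvgZ; first exact: (cvg_comp _ _ ww0 (@coord_continuous _ _ _ _ _ _)).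
apply: (@cvg_comp _ _ _ c (fun y => dmap phi y (delta_mx 0 i)) _ _ _ cz).
exact: cont_dphi Lz.
Qed.

(** [w] need only converge. With [q] along the curve as [w], this asks for continuity of [q] and not
    yet for its differentiability. *)
Lemma cvg_dphi_quot A c w t l w0 : Lam (c t) -> is_derive_within A c t l ->
  w s @[s --> within A t^'] --> w0 ->
  (s - t)^-1 *: (dmap phi (c s) (w s) - dmap phi (c t) (w s)) @[s --> within A t^']
    --> d2 (c t) l w0.
Proof.
move=> Lz cl ww0.
have E s : (s - t)^-1 *: (dmap phi (c s) (w s) - dmap phi (c t) (w s)) =
  \sum_(i < m) w s 0 i *: ((s - t)^-1 *: (dmap phi (c s) (delta_mx 0 i)
     - dmap phi (c t) (delta_mx 0 i))).
  rewrite {1 2}(row_sum_delta (w s)) !dmap_sum -sumrB scaler_sumr.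
  by apply: eq_bigr => i _; rewrite !dmapZ -scalerBr !scalerA mulrC.
under eq_fun do rewrite E.
apply: cvg_big => [|i _]; first exact: add_continuous.
apply: cvgZ; first exact: (cvg_comp _ _ ww0 (@coord_continuous _ _ _ _ _ _)).
have := derive_within_dphi Lz cl (derive_within_cst A (delta_mx 0 i) t).
rewrite dmap0 add0r /d2 (bigD1 i)//= big1 ?addr0 ?mxE ?eqxx ?scale1r//.
by move=> j /negPf ji; rewrite mxE ji andbF scale0r.
Qed.

Lemma q_cvg A c beta B t : ucurve A c beta B -> (forall u, A u -> 0 < beta u) -> A t ->
  q (c s) @[s --> within A t^'] --> q (c t).
Proof.
move=> cu beta0 At; have [K K0 HK] := dist_q_ucurve_le.
have H : K * B * `|s - t| @[s --> within A t^'] --> K * B * `|t - t|.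
  apply: cvgM; first exact: cvg_cst.
  by apply: cvg_norm; apply: cvgB; [exact: cvg_within_id|exact: cvg_cst].
rewrite subrr normr0 mulr0 in H.
apply/cvgrPdist_le => e e0; near=> s; rewrite distrC.
have As : A s by near: s; exact: near_within_mem.
have s1 : K * B * `|s - t| < 1.
  apply: le_lt_trans (ler_norm _) _; near: s.
  by move/cvgr0Pnorm_lt: H; apply.
apply: le_trans (norm_le_enorm _) _; apply: le_trans (HK _ _ _ _ _ _ cu beta0 As At s1) _.
apply: le_trans (ler_norm _) _; near: s.
by move/cvgr0Pnorm_le: H; apply.
Unshelve. all: by end_near. Qed.

Lemma gamma_cvg k A c beta B t : ucurve A c beta B -> (forall u, A u -> 0 < beta u) ->
  A t -> gamma k (c s) @[s --> within A t^'] --> gamma k (c t).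
Proof.
move=> cu beta0 At; elim: k => [|k IH]; first exact: cvg_cst.
have cuk := ucurve_iterV k.+1 cu.
have beta0k u : A u -> 0 < beta u * gamma k.+1 (c u).
  by move=> Au; rewrite mulr_gt0 ?beta0// gamma_gt0//; have [_ /(_ u Au)[]] := cu.
have qc := q_cvg cuk beta0k At.
have [_ /(_ t At)[Lt dc _]] := cuk.
have [_ /(_ t At)[L0 _ _]] := cu.
apply: cvgM => //; apply: cvgV.
  by rewrite gt_eqF// alpha_gt0//; exact: Lam_iterV.
have aE y : alpha (iter k phiV y) = enorm (dmap phi (iter k.+1 phiV y) (q (iter k.+1 phiV y))).
  by rewrite dmapE.
under eq_fun do rewrite aE.
rewrite aE; apply: cvg_enorm; apply: cvg_dphi => //.
exact: (derive_within_cvg dc).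
Qed.

Lemma q_term_cvg k A c beta B t : ucurve A c beta B -> (forall u, A u -> 0 < beta u) ->
  A t -> cvg ((s - t)^-1 *: q_term k (c s) (c t) @[s --> within A t^']).
Proof.
move=> cu beta0 At.
have cuk := ucurve_iterV k.+1 cu.
have beta0k u : A u -> 0 < beta u * gamma k.+1 (c u).
  by move=> Au; rewrite mulr_gt0 ?beta0// gamma_gt0//; have [_ /(_ u Au)[]] := cu.
have qc := q_cvg cuk beta0k At.
have [_ /(_ t At)[Lt dc _]] := cuk.
have [_ /(_ t At)[L0 _ _]] := cu.
have E s : (s - t)^-1 *: q_term k (c s) (c t) =
    gamma k.+1 (c s) *: dmap (iter k phi) (iter k phiV (c t)) (pi (iter k phiV (c t))
      ((s - t)^-1 *: (dmap phi (iter k.+1 phiV (c s)) (q (iter k.+1 phiV (c s)))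
        - dmap phi (iter k.+1 phiV (c t)) (q (iter k.+1 phiV (c s)))))).
  by rewrite /q_term scalerA mulrC -scalerA piZ dmapZ.
under eq_fun do rewrite E.
apply: is_cvgZ; first by apply: cvgP; exact: (gamma_cvg cu beta0 At).
apply: cvgP; apply: cvg_dmap; apply: cvg_pi; first exact: Lam_iterV.
exact: (cvg_dphi_quot Lt dc qc).
Qed.

(** By [q_diffE] it suffices to differentiate [pi (c t) (q (c s))]. In [q_expansion] each term is
    differentiable at [t] because [q] is continuous on curves, and the remainder divided by
    [|s - t|] is of order [lam ^+ N], by [pi_q_lipschitz] on the [N]-th backward curve. *)
Lemma q_derive_ucurve : exists2 K : R, 0 <= K & forall A c beta B t,
  ucurve A c beta B -> (forall u, A u -> 0 < beta u) -> A t ->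
  ProperFilter (within A t^') ->
  exists2 k : vec, is_derive_within A (q \o c) t k & enorm k <= K * B.
Proof.
have [K K0 HK] := dist_q_ucurve_le; have [Kp Kp0 HKp] := pi_q_lipschitz.
exists K => // A c beta B t cu beta0 At FF.
have [_ cA] := cu; have [Lt dc bB] := cA t At.
have B0 : 0 <= B by exact: le_trans bB.
have near_A : \forall s \near within A t^', A s by exact: near_within_mem.
have near_neq : \forall s \near within A t^', s != t by exact: near_within_neq.
have HD : \forall s \near within A t^', enorm (q (c s) - q (c t)) <= K * B * `|s - t|.
  have H : K * B * `|s - t| @[s --> within A t^'] --> K * B * `|t - t|.
    apply: cvgM; first exact: cvg_cst.
    by apply: cvg_norm; apply: cvgB; [exact: cvg_within_id|exact: cvg_cst].
  rewrite subrr normr0 mulr0 in H.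
  near=> s; have As : A s by near: s.
  apply: (HK _ _ _ _ _ _ cu beta0 As At).
  apply: le_lt_trans (ler_norm _) _; near: s.
  by move/cvgr0Pnorm_lt: H; apply.
have /cvg_ex[e0 He0] : cvg ((s - t)^-1 *: pi (c t) (q (c s)) @[s --> within A t^']).
  apply: cvg_near_approx => e e_gt0.
  (* [gamma N] and [dphi^N] on [Es] are each bounded by [C]; the rest is [Kp] times the speed bound
     of the [N]-th backward curve, without its [lam ^+ N]. *)
  pose X := C * (C * (Kp * (B * C))).
  have X0 : 0 <= X by rewrite !mulr_ge0// ltW.
  have [N HN] := geo_small (divr_gt0 e_gt0 (ltr_wpDl X0 ltr01)).
  exists (fun s => \sum_(k < N) (s - t)^-1 *: q_term k (c s) (c t)); split.
    have /choice[l Hl] : forall k, exists l : vec,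
        (s - t)^-1 *: q_term k (c s) (c t) @[s --> within A t^'] --> l.
      by move=> k; exact/cvg_ex/(q_term_cvg cu beta0 At).
    apply/cvg_ex; exists (\sum_(k < N) l k).
    by apply: cvg_big => [|i _]; [exact: add_continuous|exact: Hl].
  near=> s; have As : A s by near: s.
  have st : s != t by near: s.
  have [Ls _ _] := cA s As.
  rewrite (q_expansion N Ls Lt) -scaler_sumr -scalerBr addrK.
  apply: le_trans (norm_le_enorm _) _; rewrite !enormZ.
  have LtN := Lam_iterV N Lt; have LsN := Lam_iterV N Ls.
  have st0 : 0 < `|s - t| by rewrite normr_gt0 subr_eq0.
  rewrite normfV mulrC ler_pdivrMr// gtr0_norm ?gamma_gt0//.
  have HP := HKp _ _ _ _ _ _ (ucurve_iterV N cu) As At.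
  have H1 : gamma N (c s) <= C.
    rewrite (le_trans (gamma_le _ _))// ler_piMr ?(ltW C0)// exprn_ile1// ltW//.
    by case/andP: lam01.
  have H2 : enorm (dmap (iter N phi) (iter N phiV (c t))
      (pi (iter N phiV (c t)) (q (iter N phiV (c s))))) <=
      C * (Kp * (B * (C * lam ^+ N)) * `|s - t|).
    apply: le_trans (enorm_d_iter_Es _ LtN (pi_Es _ _)) _.
    apply: ler_pM => //; rewrite ?enorm_ge0 ?mulr_ge0 ?exprn_ge0 ?(ltW C0)//.
    by rewrite ler_piMr ?(ltW C0)// exprn_ile1// ltW//; case/andP: lam01.
  apply: (@le_trans _ _ (C * (C * (Kp * (B * (C * lam ^+ N)) * `|s - t|)))).
    by apply: ler_pM => //; [exact/ltW/gamma_gt0|exact: enorm_ge0].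
  have -> : C * (C * (Kp * (B * (C * lam ^+ N)) * `|s - t|)) = X * lam ^+ N * `|s - t|.
    by rewrite /X; ring.
  rewrite ler_wpM2r// (@le_trans _ _ ((X + 1) * lam ^+ N))//.
    by rewrite ler_wpM2r ?exprn_ge0// lerDl.
  by rewrite mulrC -ler_pdivlMr ?(ltW HN)// ltr_wpDl.
(* By [HD] the square is of order [|s - t| ^+ 2], so this quotient vanishes in the limit. *)
have HDD : (s - t)^-1 *: ((enorm (q (c s) - q (c t)) ^+ 2 / 2) *: q (c t))
    @[s --> within A t^'] --> (0 : vec).
  have H : (K * B) ^+ 2 / 2 * `|s - t| @[s --> within A t^'] --> (K * B) ^+ 2 / 2 * `|t - t|.
    apply: cvgM; first exact: cvg_cst.
    by apply: cvg_norm; apply: cvgB; [exact: cvg_within_id|exact: cvg_cst].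
  rewrite subrr normr0 mulr0 in H.
  apply/cvgr0Pnorm_le => e e_gt0; near=> s.
  have st : s != t by near: s.
  have st0 : 0 < `|s - t| by rewrite normr_gt0 subr_eq0.
  apply: (@le_trans _ _ ((K * B) ^+ 2 / 2 * `|s - t|)); last first.
    by apply: le_trans (ler_norm _) _; near: s; move/cvgr0Pnorm_le: H; apply.
  apply: le_trans (norm_le_enorm _) _; rewrite !enormZ enorm_q// mulr1.
  rewrite normfV mulrC ler_pdivrMr// ger0_norm ?mulr_ge0 ?exprn_ge0 ?enorm_ge0//.
  have -> : (K * B) ^+ 2 / 2 * `|s - t| * `|s - t| = (K * B * `|s - t|) ^+ 2 / 2.
    by ring.
  rewrite ler_wpM2r// ler_pXn2r ?nnegrE ?enorm_ge0 ?mulr_ge0//.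
  by near: s.
have dq : is_derive_within A (q \o c) t (e0 - dot e0 (q (c t)) *: q (c t) - 0).
  have H : (s - t)^-1 *: pi (c t) (q (c s))
      - dot ((s - t)^-1 *: pi (c t) (q (c s))) (q (c t)) *: q (c t)
      - (s - t)^-1 *: ((enorm (q (c s) - q (c t)) ^+ 2 / 2) *: q (c t))
      @[s --> within A t^'] --> e0 - dot e0 (q (c t)) *: q (c t) - 0.
    apply: cvgB; last exact: HDD.
    apply: cvgB; first exact: He0.
    apply: cvgZ; last exact: cvg_cst.
    by apply: cvg_dot; [exact: He0|exact: cvg_cst].
  apply: cvg_trans H; apply: near_eq_cvg; near=> s.
  have As : A s by near: s.
  have [Ls _ _] := cA s As.
  by rewrite /= [in RHS](q_diffE Ls Lt)/= dotZl -scalerA !scalerBr.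
exists (e0 - dot e0 (q (c t)) *: q (c t) - 0) => //.
apply: (cvgr_to_le (cvg_enorm dq)); near=> s.
have st : s != t by near: s.
rewrite enormZ normfV mulrC ler_pdivrMr ?normr_gt0 ?subr_eq0//.
by near: s.
Unshelve. all: by end_near. Qed.

(** * Local unstable manifolds and the unstable derivative *)

Section Parameterization.
Variables (eps : vec -> R) (Phi : vec -> R -> vec).
Hypothesis par : unstable_parameterization M phiV Lam q eps Phi.

Lemma dom_interval x : is_interval (dom eps x).
Proof. exact: interval_is_interval. Qed.

Lemma eps_gt0 x : Lam x -> 0 < eps x.
Proof. by case/par. Qed.

Lemma Phi0 x : Lam x -> Phi x 0 = x.
Proof. by case/par. Qed.

Lemma domE x s : dom eps x s <-> `|s| <= eps x.
Proof. by rewrite /dom /= in_itv/= ler_norml. Qed.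

Lemma dom0 x : Lam x -> dom eps x 0.
Proof. by move=> Lx; apply/domE; rewrite normr0 ltW// eps_gt0. Qed.

Lemma dom_nbhs x : Lam x -> nbhs 0 (dom eps x).
Proof.
move=> Lx; have := eps_gt0 Lx => e0.
have /near_in_itvoo : (0 : R) \in `]- eps x, eps x[ by rewrite in_itv/= oppr_lt0 e0.
apply: filterS => s; rewrite in_itv/= => /andP[s1 s2].
by rewrite /dom/= in_itv/= !ltW.
Qed.

Lemma ucurve_Phi x : Lam x -> ucurve (dom eps x) (Phi x) (fun=> 1) 1.
Proof.
move=> Lx; split=> [|s xs]; first exact: dom_interval.
by have [_ _ H1 H2 _] := par Lx; rewrite scale1r normr1; split; [exact: H1|exact: H2|].
Qed.

Lemma Phi_eq0 x s : Lam x -> dom eps x s -> Phi x s = x -> s = 0.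
Proof.
move=> Lx xs; rewrite -{2}(Phi0 Lx) => E; apply/eqP.
have cu := ucurve_Phi Lx; have x0 := dom0 Lx.
have [s0|s0|//] := ltgtP s 0.
  by case: (ucurve_no_return cu (fun _ _ => ltr01) xs x0 s0).
by case: (ucurve_no_return cu (fun _ _ => ltr01) x0 xs s0).
Qed.

(* [Phi x] is a continuous injection of a compact interval, so its inverse is
   continuous at [x]. *)
Lemma Phi_near0 x r : Lam x -> 0 < r ->
  \forall y \near x, forall s, dom eps x s -> Phi x s = y -> `|s| < r.
Proof.
move=> Lx r0; have [iA cA] := ucurve_Phi Lx.
pose K := dom eps x `&` [set s | r <= `|s|].
have cK : compact K.
  apply: compact_closedI; first exact: segment_compact.
  apply: (@closed_comp _ _ (fun s : R => `|s|) [set y | r <= y]).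
    by move=> s _; exact: norm_continuous.
  exact: closed_ge.
have : closed (Phi x @` K).
  apply: compact_closed; first exact: norm_hausdorff.
  apply: continuous_compact => //.
  apply: (@continuous_subspaceW _ _ K (dom eps x)) => [s []//|].
  apply: (derive_within_continuous (g' := fun s => q (Phi x s))) => s xs.
  by have [_] := cA s xs; rewrite scale1r.
rewrite -openC => oK.
have : (~` (Phi x @` K)) x.
  move=> [s [xs]] /= rs /(Phi_eq0 Lx xs) s0.
  by move: rs; rewrite s0 normr0 leNgt r0.
move=> xK; have : \forall y \near x, (~` (Phi x @` K)) y by exact: open_nbhs_nbhs.
apply: filterS => y yK s xs sy; rewrite ltNge; apply/negP => rs.
by apply: yK; exists s.
Qed.

(** Nothing relates the charts at different points a priori. Backward iterates of [c s] stay within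
    [B * C * |s - t|] of those of [c t], so for [s] near [t] the point [c s] lies in a small
    unstable set of [c t], hence on the chart [Phi (c t)]. *)
Lemma ucurve_transfer (W : normedModType R) (f : vec -> W) l A c beta B t :
  ucurve A c beta B -> A t ->
  is_derive_within (dom eps (c t)) (f \o Phi (c t)) 0 l ->
  is_derive_within A (f \o c) t (beta t *: l).
Proof.
move=> cu At fl; have [iA cA] := cu; have [Lz dc bB] := cA t At.
set z := c t in fl Lz *.
have B0 : 0 <= B by exact: le_trans bB.
have BC : 0 < B * C + 1 by rewrite ltr_wpDl// mulr_ge0// ltW.
have [_ _ _ dPhi [_ [delta delta0 Hdelta]]] := par Lz.
have near_t : \forall s \near t, `|t - s| <= delta / (B * C + 1).
  have := @cvg_id _ (nbhs t) => /cvgrPdist_le; apply; exact: divr_gt0.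
have ex : \forall s \near within A t^', exists u, dom eps z u /\ Phi z u = c s.
  apply: near_within_dnbhs; near=> s => st As.
  have [Ls _ _] := cA s As.
  have : (Phi z @` dom eps z) (c s).
    apply: Hdelta; split; first exact: LamM.
    move=> n; apply: le_trans (ucurve_lipschitz (ucurve_iterV n cu) As At) _.
    apply: (@le_trans _ _ ((B * C + 1) * `|s - t|)).
      rewrite ler_wpM2r// mulrA; apply: (@le_trans _ _ (B * C)); last by rewrite lerDl.
      case/andP: lam01 => l0 l1.
      by rewrite ler_piMr ?mulr_ge0 ?exprn_ile1// ltW.
    rewrite -ler_pdivlMl// mulrC distrC; near: s.
    exact: near_t.
  by move=> [u xu uc]; exists u.
(* The default [0] is taken only where [c s] is off the chart, which [ex] excludes for [s] in [A]
   near [t]. *)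
pose tau s := xget 0 [set u | dom eps z u /\ Phi z u = c s].
have tauP : \forall s \near within A t^', dom eps z (tau s) /\ Phi z (tau s) = c s.
  near=> s; have [u Hu] : exists u, dom eps z u /\ Phi z u = c s by near: s.
  by rewrite /tau; case: xgetP => [v _ []//|/(_ u)].
apply: (@derive_within_reparam _ _ _ f (dom eps z) A (Phi z) c tau 0 t (beta t) (q z)) => //.
- by have := dPhi 0 (dom0 Lz); rewrite Phi0.
- exact: enorm_q.
- exact: Phi0.
apply/cvgr0Pnorm_lt => e e0; near=> s.
have [] : dom eps z (tau s) /\ Phi z (tau s) = c s by near: s.
have : forall u, dom eps z u -> Phi z u = c s -> `|u| < e.
  near: s; have := Phi_near0 Lz e0.
  exact: (derive_within_cvg dc).
by move=> H; exact: H.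
Unshelve. all: by end_near. Qed.

Definition is_uderive (W : normedModType R) (f : vec -> W) (x : vec) (l : W) : Prop :=
  is_derive_within (dom eps x) (f \o Phi x) 0 l.

Lemma dom_proper x : Lam x -> ProperFilter (within (dom eps x) (0 : R)^').
Proof.
move=> Lx; rewrite derive_within_interior; last exact: dom_nbhs.
exact: Proper_dnbhs_numFieldType.
Qed.

Lemma is_uderive_unique (W : normedModType R) (f : vec -> W) x l k : Lam x ->
  is_uderive f x l -> is_uderive f x k -> l = k.
Proof. by move=> Lx; have := dom_proper Lx => FF; exact: cvg_unique. Qed.

Lemma is_uderive_derive (W : normedModType R) (f : vec -> W) x l : Lam x ->
  is_uderive f x l -> unstable_derive Phi f x = l.
Proof.
move=> Lx /(is_derive_within_interior _ _ (dom_nbhs Lx)) H.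
by rewrite /unstable_derive derive1E derive_val.
Qed.

Lemma unstable_differentiable_uderive (W : normedModType R) (f : vec -> W) x :
  unstable_differentiable Lam eps Phi f -> Lam x -> is_uderive f x (unstable_derive Phi f x).
Proof.
by move=> H Lx; have [l fl] := H x Lx 0 (dom0 Lx); rewrite (is_uderive_derive Lx fl).
Qed.

(** Derivatives at the centers of all charts suffice: [Phi x] is an unstable curve through
    [Phi x s], so the derivative at the center of the chart there transfers to it. *)
Lemma uderive_unstable_differentiable (W : normedModType R) (f f' : vec -> W) :
  (forall x, Lam x -> is_uderive f x (f' x)) -> unstable_differentiable Lam eps Phi f.
Proof.
move=> ff' x Lx s xs; have cu := ucurve_Phi Lx.
have [_ _ /(_ s xs) Ls _ _] := par Lx.
exists (1 *: f' (Phi x s)).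
exact: (ucurve_transfer cu xs (ff' _ Ls)).
Qed.

(** The curve [phiV \o Phi x] passes through [phiV x] with speed [gamma 1 x], the inverse of
    [alpha x]. *)
Lemma is_uderive_phiV (W : normedModType R) (f : vec -> W) x l : Lam x ->
  is_uderive f (phiV x) l -> is_uderive (f \o phiV) x ((alpha x)^-1 *: l).
Proof.
move=> Lx fl; have cu := ucurve_iterV 1 (ucurve_Phi Lx).
have := @ucurve_transfer W f l _ _ _ _ 0 cu (dom0 Lx).
by rewrite /= Phi0// !mul1r; exact.
Qed.

Lemma is_uderiveD (W : normedModType R) (f g : vec -> W) x l k :
  is_uderive f x l -> is_uderive g x k ->
  is_uderive (fun y => f y + g y) x (l + k).
Proof. exact: derive_withinD. Qed.

Lemma is_uderiveB (W : normedModType R) (f g : vec -> W) x l k :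
  is_uderive f x l -> is_uderive g x k ->
  is_uderive (fun y => f y - g y) x (l - k).
Proof. exact: derive_withinB. Qed.

Lemma is_uderiveZ (W : normedModType R) (a : vec -> R) (f : vec -> W) x a' l : Lam x ->
  is_uderive a x a' -> is_uderive f x l ->
  is_uderive (fun y => a y *: f y) x (a x *: l + a' *: f x).
Proof. by move=> Lx aa' fl; have := derive_withinZ aa' fl; rewrite /= Phi0. Qed.

Lemma is_uderive_dot (f g : vec -> vec) x l k : Lam x -> is_uderive f x l -> is_uderive g x k ->
  is_uderive (fun y => dot (f y) (g y)) x (dot (f x) k + dot l (g x)).
Proof. by move=> Lx fl gk; have := derive_within_dot fl gk; rewrite /= Phi0. Qed.

Lemma is_uderive_diff (f : vec -> vec) x : Lam x -> differentiable f x ->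
  is_uderive f x (dmap f x (q x)).
Proof.
move=> Lx df; rewrite dmapE.
have [_ /(_ 0 (dom0 Lx))[_ dPhi _]] := ucurve_Phi Lx.
rewrite scale1r Phi0// in dPhi.
have := @derive_within_diff R _ _ f (Phi x) (dom eps x) 0 (q x).
by rewrite Phi0//; apply.
Qed.

Lemma is_uderive_dphi (v : vec -> vec) x w : Lam x -> is_uderive v x w ->
  is_uderive (fun y => dmap phi y (v y)) x (dmap phi x w + d2 x (q x) (v x)).
Proof.
move=> Lx vw; have [_ /(_ 0 (dom0 Lx))[LP dPhi _]] := ucurve_Phi Lx.
rewrite scale1r Phi0// in dPhi.
by have := derive_within_dphi LP dPhi vw; rewrite /= Phi0.
Qed.

Lemma q_uderive : exists (kappa : vec -> vec) (K : R), 0 <= K /\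
  forall x, Lam x -> is_uderive q x (kappa x) /\ enorm (kappa x) <= K.
Proof.
have [K K0 HK] := q_derive_ucurve.
have /choice[kappa Hk] : forall x, exists k, Lam x -> is_uderive q x k /\ enorm k <= K.
  move=> x; have [Lx|nLx] := pselect (Lam x); last by exists 0.
  have [k dk kK] := HK _ _ _ _ _ (ucurve_Phi Lx) (fun _ _ => ltr01) (dom0 Lx) (dom_proper Lx).
  by exists k => _; split=> //; rewrite mulr1 in kK.
by exists kappa, K.
Qed.

(** * The orthogonalized iteration *)

Section Decomposition.
Variables (chi v0 : vec -> vec).
Hypothesis diff_chi : forall x, M x -> differentiable chi x.
Hypothesis chi_bounded : bounded_field M chi.
Hypothesis dchi_bounded : bounded_differential M chi.
Hypothesis v0_bounded : bounded_field Lam v0.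
Hypothesis v0_uderive : unstable_differentiable Lam eps Phi v0.

(** [vseq] takes the coefficients as given, whereas each of them depends on the preceding field.
    Substituting the inner product with [q] for the coefficient removes the circularity. *)
Fixpoint orth_field n : vec -> vec :=
  if n is n'.+1 then fun x =>
    let u := dmap phi (phiV x) (orth_field n' (phiV x)) + chi x in
    u - dot u (q x) *: q x
  else v0.

Definition coef n : vec -> R :=
  if n is n'.+1 then fun x =>
    dot (dmap phi (phiV x) (orth_field n' (phiV x)) + chi x) (q x)
  else fun=> 0.

Local Notation v := orth_field.
Local Notation a := coef.

Lemma orth_fieldS n x :
  v n.+1 x = dmap phi (phiV x) (v n (phiV x)) + chi x - a n.+1 x *: q x.
Proof. by []. Qed.

Lemma vseq_coef n : vseq phi phiV q chi a v0 n = v n.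
Proof.
by elim: n => // n IH; apply/funext => x; rewrite orth_fieldS dmapE /= /pushforward IH addrA.
Qed.

Lemma orth_field_q n x : Lam x -> dot (v n.+1 x) (q x) = 0.
Proof. by move=> Lx; rewrite /= dotBl dotZl dot_qq// mulr1 subrr. Qed.

(** A vector is recovered from two quantities that are controlled differently: its stable projection
    by contraction, its product with [q] by orthogonality. *)
Lemma enorm_le_pi x u : Lam x -> enorm u <= 2 * enorm (pi x u) + `|dot u (q x)|.
Proof.
move=> Lx; have E := Eu_q Lx (pi_split u Lx).
rewrite -{1}(subrK (pi x u) u) E dotBl; apply: le_trans (ler_enormD _ _) _.
rewrite enormZ enorm_q// mulr1.
have := ler_normB (dot u (q x)) (dot (pi x u) (q x)).
have := ler_dot_enorm (pi x u) (q x); rewrite enorm_q// mulr1; lra.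
Qed.

Lemma alphaV_le x : Lam x -> (alpha x)^-1 <= C.
Proof.
move=> Lx; have := gamma_le 1 Lx; rewrite /= mul1r expr1 => /le_trans; apply.
by case/andP: lam01 => l0 l1; rewrite ler_piMr// ltW.
Qed.

(* Weighting by the contraction [gamma j] along the backward orbit turns the
   constant [C] into a uniform one, which makes the induction on [n] close up. *)
Lemma cohomological_geometric (del g : nat -> vec -> vec) (K0 K : R) :
  (forall n x, Lam x -> del n x \in Es x) -> (forall n x, Lam x -> g n x \in Es x) ->
  (forall n x, Lam x -> del n.+1 x =
     (alpha x)^-1 *: dmap phi (phiV x) (del n (phiV x)) + g n x) ->
  (forall x, Lam x -> enorm (del 0%N x) <= K0) ->
  (forall n x, Lam x -> enorm (g n x) <= K * lam ^+ n) -> 0 <= K0 -> 0 <= K ->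
  exists2 Y : R, 0 <= Y & forall n x, Lam x -> enorm (del n x) <= Y * lam ^+ n.
Proof.
move=> delE gE delS del0 gK K00 K_0; case/andP: (lam01) => l0 l1.
(* The summand in [K] gives [Y * (lam * lam) + C * C * K <= Y * lam], which closes the inductive
   step; [K0] starts the induction. *)
pose Y := C * C * (K0 + K / (lam * (1 - lam))).
have l1' : 0 < 1 - lam by rewrite subr_gt0.
have Y0 : 0 <= Y by rewrite !mulr_ge0 ?(ltW C0)// addr_ge0// divr_ge0// mulr_ge0// ltW.
exists Y => //.
have gdE j x u : Lam x -> u \in Es (iter j phiV x) ->
    enorm (gamma j x *: dmap (iter j phi) (iter j phiV x) u) <= C * C * lam ^+ (j + j) * enorm u.
  move=> Lx uE; have Lj := Lam_iterV j Lx; rewrite enormZ gtr0_norm ?gamma_gt0//.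
  apply: (@le_trans _ _ (C * lam ^+ j * (C * lam ^+ j * enorm u))).
    apply: ler_pM; [exact/ltW/gamma_gt0|exact: enorm_ge0|exact: gamma_le|].
    exact: enorm_d_iter_Es.
  by rewrite exprD le_eqVlt; apply/orP; left; apply/eqP; ring.
(* Passing from [n.+1], [j] to [n], [j.+1] yields an exponent one larger than required; the spare
   factor [lam] makes room for the forcing term. *)
have claim n : forall j x, Lam x -> enorm (gamma j x *: dmap (iter j phi) (iter j phiV x)
    (del n (iter j phiV x))) <= Y * lam ^+ (n + (j + j)).
  elim: n => [|n IH] j x Lx; have Lj := Lam_iterV j Lx.
    apply: le_trans (gdE _ _ _ Lx (delE _ _ Lj)) _; rewrite add0n.
    rewrite mulrAC ler_wpM2r ?exprn_ge0//; apply: ler_wpM2l; first by rewrite mulr_ge0// ltW.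
    by apply: le_trans (del0 _ Lj) _; rewrite lerDl divr_ge0// mulr_ge0// ltW.
  rewrite delS// dmapD dmapZ scalerDr scalerA.
  have -> : gamma j x / alpha (iter j phiV x) = gamma j.+1 x by [].
  have -> : dmap (iter j phi) (iter j phiV x) (dmap phi (phiV (iter j phiV x))
      (del n (phiV (iter j phiV x)))) =
      dmap (iter j.+1 phi) (iter j.+1 phiV x) (del n (iter j.+1 phiV x)).
    by rewrite d_iterSr/= ?phiVK//; exact: Lam_phiV.
  apply: le_trans (ler_enormD _ _) _.
  apply: le_trans (lerD (IH j.+1 x Lx) (gdE _ _ _ Lx (gE n _ Lj))) _.
  apply: (@le_trans _ _ (Y * lam ^+ (n + (j.+1 + j.+1)) + C * C * lam ^+ (j + j) * (K * lam ^+ n))).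
    rewrite lerD2l; apply: ler_wpM2l; last exact: gK.
    by rewrite !mulr_ge0 ?exprn_ge0// ltW.
  rewrite (_ : n + (j.+1 + j.+1) = (n + (j + j)).+2)%N; last by lia.
  have -> : C * C * lam ^+ (j + j) * (K * lam ^+ n) = C * C * K * lam ^+ (n + (j + j)).
    by rewrite !exprD; ring.
  rewrite addSn !exprS.
  have H : 0 <= lam ^+ (n + (j + j)) by rewrite exprn_ge0.
  move: (lam ^+ (n + (j + j))) H => P P0.
  have H : Y * (lam * lam) + C * C * K <= Y * lam.
    have E : Y * lam - Y * (lam * lam) = C * C * K0 * (lam * (1 - lam)) + C * C * K.
      by rewrite /Y; field; rewrite subr_eq0 eq_sym lt_eqF// gt_eqF.
    suff : 0 <= C * C * K0 * (lam * (1 - lam)) by lra.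
    by rewrite !mulr_ge0// ltW.
  have := ler_wpM2r P0 H; lra.
by move=> n x Lx; have := claim n 0%N x Lx; rewrite !addn0 scale1r d_iter0.
Qed.

Lemma d2B x u w1 w2 : d2 x u (w1 - w2) = d2 x u w1 - d2 x u w2.
Proof. by rewrite /d2 -sumrB; apply: eq_bigr => i _; rewrite -scalerBl !mxE. Qed.

Let u0 x : vec := dmap phi (phiV x) (v0 (phiV x)) + chi x.

Let u0_bound : exists2 B : R, 0 <= B & forall x, Lam x -> enorm (u0 x) <= B.
Proof.
have [L L0 HL] := dphi_bound; have [B0 HB0] := v0_bounded; have [Bc HBc] := chi_bounded.
exists (L * `|B0| + `|Bc|); first by rewrite addr_ge0// mulr_ge0.
move=> x Lx; have Ly := Lam_phiV Lx; apply: le_trans (ler_enormD _ _) _; apply: lerD.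
  apply: le_trans (HL _ _ Ly) _; apply: ler_wpM2l => //.
  exact: le_trans (HB0 _ Ly) (ler_norm _).
exact: le_trans (HBc _ (LamM Lx)) (ler_norm _).
Qed.

Lemma orth_field_diffS n x : v n.+2 x - v n.+1 x =
  dmap phi (phiV x) (v n.+1 (phiV x) - v n (phiV x)) - (a n.+2 x - a n.+1 x) *: q x.
Proof.
rewrite (orth_fieldS n.+1 x) (orth_fieldS n x) dmapB scalerBl.
by apply/rowP => i; rewrite !mxE; ring.
Qed.

Lemma pi_dphiV x u : Lam x ->
  pi x (dmap phi (phiV x) u) = dmap phi (phiV x) (pi (phiV x) u).
Proof. by move=> Lx; rewrite -pi_dphi ?phiVK//; exact: Lam_phiV. Qed.

(** Subtracting consecutive steps cancels [chi], and [pi] kills the multiple of [q], so no estimate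
    of the coefficients enters. *)
Lemma pi_orth_field_diff n x : Lam x -> pi x (v n.+1 x - v n x) =
  dmap (iter n phi) (iter n phiV x)
    (pi (iter n phiV x) (v 1 (iter n phiV x) - v 0 (iter n phiV x))).
Proof.
elim: n x => [|n IH] x Lx; first by rewrite d_iter0.
have Ly := Lam_phiV Lx; have Lz := Lam_iterV n Ly.
rewrite orth_field_diffS piB piZ pi_q// scaler0 subr0 pi_dphiV// IH//.
by rewrite iterSr d_iterS// iter_phiVK.
Qed.

Lemma orth_field_geometric : exists2 K : R, 0 <= K &
  forall n x, Lam x -> enorm (v n.+1 x - v n x) <= K * lam ^+ n.
Proof.
have [BU BU0 HU] := u0_bound; have [B0 HB0] := v0_bounded.
have [Kp Kp0 HKp] := pi_bound; case/andP: (lam01) => l0 l1.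
pose B1 := 2 * BU + `|B0|.
have B10 : 0 <= B1 by rewrite addr_ge0// mulr_ge0.
have HB1 x : Lam x -> enorm (v 1 x - v 0 x) <= B1.
  move=> Lx; apply: le_trans (ler_enormD _ _) _; rewrite enormN; apply: lerD; last first.
    exact: le_trans (HB0 _ Lx) (ler_norm _).
  rewrite /= -/(u0 x); apply: le_trans (ler_enormD _ _) _.
  rewrite enormN enormZ enorm_q// mulr1.
  have := ler_dot_enorm (u0 x) (q x); rewrite enorm_q// mulr1.
  have := HU x Lx; lra.
have CK0 : 0 <= 2 * (C * (Kp * B1)) by rewrite !mulr_ge0// ltW.
exists (B1 + 2 * (C * (Kp * B1))); first by rewrite addr_ge0.
(* [v 0] is arbitrary, so both fields are orthogonal to [q] only from the second increment on. *)
move=> [|n] x Lx; first by rewrite expr0 mulr1 (le_trans (HB1 x Lx))// lerDl.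
apply: le_trans (enorm_le_pi _ Lx) _.
rewrite dotBl !orth_field_q// subrr normr0 addr0 pi_orth_field_diff//.
have Lz := Lam_iterV n.+1 Lx.
apply: (@le_trans _ _ (2 * (C * (Kp * B1)) * lam ^+ n.+1)); last first.
  by rewrite ler_wpM2r ?exprn_ge0// lerDr.
rewrite -(mulrA 2) ler_pM2l//; apply: le_trans (enorm_d_iter_Es _ Lz (pi_Es _ _)) _.
rewrite mulrAC ler_wpM2r ?exprn_ge0//; apply: ler_wpM2l; first exact: ltW.
by apply: le_trans (HKp _ _ Lz) _; apply: ler_wpM2l => //; exact: HB1.
Qed.

Lemma coef_geometric : exists2 K : R, 0 <= K &
  forall n x, Lam x -> `|a n.+2 x - a n.+1 x| <= K * lam ^+ n.
Proof.
have [L L0 HL] := dphi_bound; have [K K0 HK] := orth_field_geometric.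
exists (L * K); first exact: mulr_ge0.
move=> n x Lx; have Ly := Lam_phiV Lx.
have -> : a n.+2 x - a n.+1 x =
    dot (dmap phi (phiV x) (v n.+1 (phiV x) - v n (phiV x))) (q x).
  rewrite -[a n.+2 x]/(dot (dmap phi (phiV x) (v n.+1 (phiV x)) + chi x) (q x)).
  rewrite -[a n.+1 x]/(dot (dmap phi (phiV x) (v n (phiV x)) + chi x) (q x)).
  by rewrite dmapB -dotBl opprD addrACA subrr addr0.
apply: le_trans (ler_dot_enorm _ _) _; rewrite enorm_q// mulr1.
by apply: le_trans (HL _ _ Ly) _; rewrite -mulrA ler_wpM2l// HK.
Qed.

(** * Unstable derivatives of the iterates *)

Section Derivatives.
Variables (kappa : vec -> vec) (Kk : R).
Hypotheses (Kk0 : 0 <= Kk) (q_kappa : forall x, Lam x -> is_uderive q x (kappa x)).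
Hypothesis kappa_le : forall x, Lam x -> enorm (kappa x) <= Kk.

(** The recursion of [orth_field] differentiated formally: [(alpha x)^-1] is the speed of [phiV]
    along unstable curves, [d2] comes from the moving base point of [dphi], and [kappa] from [q].
    [is_uderive_orth_field] justifies it. *)
Fixpoint d_orth_field n : vec -> vec :=
  if n is n'.+1 then fun x =>
    let y := phiV x in
    let du := (alpha x)^-1 *: (dmap phi y (d_orth_field n' y) + d2 y (q y) (v n' y))
              + dmap chi x (q x) in
    let b := dot (dmap phi y (v n' y) + chi x) (kappa x) + dot du (q x) in
    du - (a n'.+1 x *: kappa x + b *: q x)
  else unstable_derive Phi v0.

Local Notation w := d_orth_field.

Definition d_coef n : vec -> R :=
  if n is n'.+1 then fun x =>
    let y := phiV x in
    dot (dmap phi y (v n' y) + chi x) (kappa x) +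
    dot ((alpha x)^-1 *: (dmap phi y (w n' y) + d2 y (q y) (v n' y))
         + dmap chi x (q x)) (q x)
  else fun=> 0.

Local Notation b := d_coef.

Lemma d_orth_fieldS n x : w n.+1 x =
  (alpha x)^-1 *: (dmap phi (phiV x) (w n (phiV x))
                   + d2 (phiV x) (q (phiV x)) (v n (phiV x)))
  + dmap chi x (q x) - (a n.+1 x *: kappa x + b n.+1 x *: q x).
Proof. by []. Qed.

Let is_uderive_drive n x : Lam x -> (forall y, Lam y -> is_uderive (v n) y (w n y)) ->
  is_uderive (fun y => dmap phi (phiV y) (v n (phiV y)) + chi y) x
   ((alpha x)^-1 *: (dmap phi (phiV x) (w n (phiV x))
       + d2 (phiV x) (q (phiV x)) (v n (phiV x))) + dmap chi x (q x)).
Proof.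
move=> Lx vw; have Ly := Lam_phiV Lx; apply: is_uderiveD.
  exact: (is_uderive_phiV Lx (is_uderive_dphi Ly (vw _ Ly))).
by apply: is_uderive_diff => //; exact/diff_chi/LamM.
Qed.

Let is_uderive_coefS n x : Lam x -> (forall y, Lam y -> is_uderive (v n) y (w n y)) ->
  is_uderive (a n.+1) x (b n.+1 x).
Proof. by move=> Lx vw; exact: (is_uderive_dot Lx (is_uderive_drive Lx vw) (q_kappa Lx)). Qed.

Lemma is_uderive_orth_field n x : Lam x -> is_uderive (v n) x (w n x).
Proof.
elim: n x => [|n IH] x Lx; first exact: unstable_differentiable_uderive.
apply: is_uderiveB; first exact: is_uderive_drive.
by apply: (is_uderiveZ Lx); [exact: is_uderive_coefS|exact: q_kappa].
Qed.

Lemma is_uderive_coef n x : Lam x -> is_uderive (a n.+1) x (b n.+1 x).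
Proof. by move=> Lx; apply: is_uderive_coefS => // y Ly; exact: is_uderive_orth_field. Qed.

Lemma d_orth_field_q n x : Lam x ->
  dot (w n.+1 x) (q x) = - dot (v n.+1 x) (kappa x).
Proof.
move=> Lx; have H := is_uderive_dot Lx (@is_uderive_orth_field n.+1 x Lx) (q_kappa Lx).
have H0 : is_uderive (fun y => dot (v n.+1 y) (q y)) x 0.
  apply: (@eq_derive_within _ _ _ (fun=> 0)); first exact: dom0.
    move=> s xs; have [_ _ /(_ s xs) Ls _ _] := par Lx.
    by rewrite /= -orth_fieldS orth_field_q.
  exact: derive_within_cst.
have := is_uderive_unique Lx H H0; lra.
Qed.

Lemma d_orth_field_diffS n x : w n.+2 x - w n.+1 x =
  (alpha x)^-1 *: (dmap phi (phiV x) (w n.+1 (phiV x) - w n (phiV x))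
     + d2 (phiV x) (q (phiV x)) (v n.+1 (phiV x) - v n (phiV x)))
  - (a n.+2 x - a n.+1 x) *: kappa x - (b n.+2 x - b n.+1 x) *: q x.
Proof.
rewrite (d_orth_fieldS n.+1 x) (d_orth_fieldS n x) dmapB.
rewrite (d2B _ _ (v n.+1 (phiV x)) (v n (phiV x))) !scalerBl.
by apply/rowP => i; rewrite !mxE; ring.
Qed.

(** This is [w 0]; its bound starts the geometric estimate of the increments of [w]. *)
Hypothesis dv0_bounded : bounded_field Lam (unstable_derive Phi v0).

Let w1_bound : exists2 B : R, 0 <= B & forall x, Lam x -> enorm (w 1 x) <= B.
Proof.
have [BU BU0 HU] := u0_bound; have [B0 HB0] := v0_bounded.
have [L L0 HL] := dphi_bound; have [K2 K20 HK2] := d2_bound.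
have [W0 HW0] := dv0_bounded; have [Bd HBd] := dchi_bounded.
pose BG := C * (L * `|W0| + K2 * `|B0|) + `|Bd|.
have BG0 : 0 <= BG.
  by rewrite !(addr_ge0, mulr_ge0)// ltW.
have BUk : 0 <= BU * Kk by exact: mulr_ge0.
exists (BG + (BU * Kk + (BU * Kk + BG))).
  by apply: addr_ge0 => //; apply: addr_ge0 => //; exact: addr_ge0.
move=> x Lx; have Ly := Lam_phiV Lx.
rewrite d_orth_fieldS; set G := _ *: _ + _.
have HG : enorm G <= BG.
  apply: le_trans (ler_enormD _ _) _; apply: lerD.
    rewrite enormZ ger0_norm ?invr_ge0 ?(ltW (alpha_gt0 Lx))//.
    apply: ler_pM; rewrite ?enorm_ge0 ?invr_ge0 ?(ltW (alpha_gt0 Lx)) ?alphaV_le//.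
    apply: le_trans (ler_enormD _ _) _; apply: lerD.
      apply: le_trans (HL _ _ Ly) _; apply: ler_wpM2l => //.
      exact: le_trans (HW0 _ Ly) (ler_norm _).
    apply: le_trans (HK2 _ _ _ Ly) _; rewrite enorm_q// mulr1; apply: ler_wpM2l => //.
    exact: le_trans (HB0 _ Ly) (ler_norm _).
  rewrite dmapE; apply: le_trans (HBd _ (LamM Lx) _) _.
  by rewrite enorm_q// mulr1 ler_norm.
have Ha : `|a 1 x| <= BU.
  apply: le_trans (ler_dot_enorm _ _) _; rewrite enorm_q// mulr1; exact: HU.
have Huk : `|dot (u0 x) (kappa x)| <= BU * Kk.
  apply: le_trans (ler_dot_enorm _ _) _.
  by apply: ler_pM; rewrite ?enorm_ge0 ?HU ?kappa_le.
have Hb : `|b 1 x| <= BU * Kk + BG.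
  apply: le_trans (ler_normD _ _) _; apply: lerD; first exact: Huk.
  by apply: le_trans (ler_dot_enorm _ _) _; rewrite enorm_q// mulr1.
apply: le_trans (ler_enormD _ _) _; apply: lerD => //; rewrite enormN.
apply: le_trans (ler_enormD _ _) _; rewrite !enormZ enorm_q// mulr1; apply: lerD => //.
by apply: ler_pM; rewrite ?enorm_ge0 ?kappa_le.
Qed.

(** The increment of [b] multiplies [q] and disappears under [pi], so [w] is estimated before [b].
    The forcing [h] that remains contains only increments of [v] and [a], already known to be
    geometric. *)
Lemma d_orth_field_geometric : exists2 K : R, 0 <= K &
  forall n x, Lam x -> enorm (w n.+1 x - w n x) <= K * lam ^+ n.
Proof.
have [B1 B10 HB1] := w1_bound; have [W0 HW0] := dv0_bounded.
have [Kp Kp0 HKp] := pi_bound; have [K2 K20 HK2] := d2_bound.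
have [Kv Kv0 HKv] := orth_field_geometric; have [Ka Ka0 HKa] := coef_geometric.
case/andP: (lam01) => l0 l1.
have Hd x : Lam x -> enorm (w 1 x - w 0 x) <= B1 + `|W0|.
  move=> Lx; apply: le_trans (ler_enormD _ _) _; rewrite enormN; apply: lerD.
    exact: HB1.
  exact: le_trans (HW0 _ Lx) (ler_norm _).
pose del n x := pi x (w n.+1 x - w n x).
pose h n x := (alpha x)^-1 *: d2 (phiV x) (q (phiV x)) (v n.+1 (phiV x) - v n (phiV x))
  - (a n.+2 x - a n.+1 x) *: kappa x.
pose Kh := C * (K2 * Kv) + Ka * Kk.
have Kh0 : 0 <= Kh by rewrite addr_ge0// !mulr_ge0// ltW.
have hK n x : Lam x -> enorm (h n x) <= Kh * lam ^+ n.
  move=> Lx; have Ly := Lam_phiV Lx; apply: le_trans (ler_enormD _ _) _.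
  rewrite enormN !enormZ ger0_norm ?invr_ge0 ?(ltW (alpha_gt0 Lx))// [leRHS]mulrDl.
  apply: lerD.
    rewrite -mulrA; apply: ler_pM; rewrite ?enorm_ge0 ?invr_ge0 ?(ltW (alpha_gt0 Lx)) ?alphaV_le//.
    apply: le_trans (HK2 _ _ _ Ly) _; rewrite enorm_q// mulr1 -mulrA.
    by apply: ler_wpM2l => //; exact: HKv.
  rewrite mulrAC; apply: ler_pM; rewrite ?enorm_ge0 ?kappa_le//; exact: HKa.
have [|||||||Y Y0 HY] := @cohomological_geometric del (fun n x => pi x (h n x))
    (Kp * (B1 + `|W0|)) (Kp * Kh).
- by move=> n x _; exact: pi_Es.
- by move=> n x _; exact: pi_Es.
- move=> n x Lx; have Ly := Lam_phiV Lx.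
  rewrite /del d_orth_field_diffS piB piZ pi_q// scaler0 subr0 scalerDr -addrA [LHS]piD.
  by rewrite piZ pi_dphiV.
- move=> x Lx; apply: le_trans (HKp _ _ Lx) _; apply: ler_wpM2l => //; exact: Hd.
- move=> n x Lx; apply: le_trans (HKp _ _ Lx) _; rewrite -mulrA; apply: ler_wpM2l => //.
  exact: hK.
- by rewrite mulr_ge0// addr_ge0.
- exact: mulr_ge0.
have YK0 : 0 <= 2 * Y + Kv * Kk by rewrite addr_ge0// mulr_ge0.
exists (B1 + `|W0| + (2 * Y + Kv * Kk)); first by rewrite addr_ge0// addr_ge0.
move=> [|n] x Lx; first by rewrite expr0 mulr1 (le_trans (Hd x Lx))// lerDl.
apply: (@le_trans _ _ ((2 * Y + Kv * Kk) * lam ^+ n.+1)); last first.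
  by rewrite ler_wpM2r ?exprn_ge0// lerDr addr_ge0.
apply: le_trans (enorm_le_pi _ Lx) _; rewrite [leRHS]mulrDl; apply: lerD.
  by rewrite -mulrA ler_pM2l//; exact: HY.
rewrite dotBl !d_orth_field_q// opprK addrC -dotBl.
apply: le_trans (ler_dot_enorm _ _) _; rewrite mulrAC.
apply: ler_pM; rewrite ?enorm_ge0 ?kappa_le//.
by rewrite enormB; exact: HKv.
Qed.

Lemma d_coef_geometric : exists2 K : R, 0 <= K &
  forall n x, Lam x -> `|b n.+2 x - b n.+1 x| <= K * lam ^+ n.
Proof.
have [L L0 HL] := dphi_bound; have [K2 K20 HK2] := d2_bound.
have [Kv Kv0 HKv] := orth_field_geometric; have [Kw Kw0 HKw] := d_orth_field_geometric.
exists (L * Kv * Kk + C * (L * Kw + K2 * Kv)).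
  by rewrite !(addr_ge0, mulr_ge0)// ltW.
move=> n x Lx; have Ly := Lam_phiV Lx.
set dv := v n.+1 (phiV x) - v n (phiV x); set dw := w n.+1 (phiV x) - w n (phiV x).
have -> : b n.+2 x - b n.+1 x = dot (dmap phi (phiV x) dv) (kappa x) +
    dot ((alpha x)^-1 *: (dmap phi (phiV x) dw + d2 (phiV x) (q (phiV x)) dv)) (q x).
  rewrite (_ : b n.+2 x = dot (dmap phi (phiV x) (v n.+1 (phiV x)) + chi x) (kappa x) +
    dot ((alpha x)^-1 *: (dmap phi (phiV x) (w n.+1 (phiV x))
      + d2 (phiV x) (q (phiV x)) (v n.+1 (phiV x))) + dmap chi x (q x)) (q x))//.
  rewrite (_ : b n.+1 x = dot (dmap phi (phiV x) (v n (phiV x)) + chi x) (kappa x) +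
    dot ((alpha x)^-1 *: (dmap phi (phiV x) (w n (phiV x))
      + d2 (phiV x) (q (phiV x)) (v n (phiV x))) + dmap chi x (q x)) (q x))//.
  rewrite /dv /dw !dmapB (d2B _ _ (v n.+1 (phiV x)) (v n (phiV x))).
  by rewrite !(dotDl, dotZl, dotNl); ring.
have Hdv : enorm (dmap phi (phiV x) dv) <= L * (Kv * lam ^+ n).
  by apply: le_trans (HL _ _ Ly) _; apply: ler_wpM2l => //; exact: HKv.
rewrite [leRHS]mulrDl; apply: le_trans (ler_normD _ _) _; apply: lerD.
  rewrite mulrAC -(mulrA L); apply: le_trans (ler_dot_enorm _ _) _.
  by apply: ler_pM; rewrite ?enorm_ge0 ?kappa_le.
apply: le_trans (ler_dot_enorm _ _) _; rewrite enorm_q// mulr1 enormZ.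
rewrite ger0_norm ?invr_ge0 ?(ltW (alpha_gt0 Lx))// -mulrA.
apply: ler_pM; rewrite ?enorm_ge0 ?invr_ge0 ?(ltW (alpha_gt0 Lx)) ?alphaV_le//.
rewrite [leRHS]mulrDl; apply: le_trans (ler_enormD _ _) _; apply: lerD.
  apply: le_trans (HL _ _ Ly) _; rewrite -mulrA; apply: ler_wpM2l => //; exact: HKw.
apply: le_trans (HK2 _ _ _ Ly) _; rewrite enorm_q// mulr1 -mulrA.
by apply: ler_wpM2l => //; exact: HKv.
Qed.

End Derivatives.

Lemma orthogonal_decomposition : exists a : nat -> vec -> R,
  let v := vseq phi phiV q chi a v0 in
  [/\ (forall n x, (1 <= n)%N -> Lam x -> dot (v n x) (q x) = 0) /\
        cvg_uniformly_on Lam v,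
      (forall n, (1 <= n)%N -> unstable_differentiable Lam eps Phi (a n)) /\
        cvg_uniformly_on Lam a &
      bounded_field Lam (unstable_derive Phi v0) ->
        cvg_uniformly_on Lam (fun n => unstable_derive Phi (a n))].
Proof.
have [kappa [Kk [Kk0 Hk]]] := q_uderive.
have q_kappa x : Lam x -> is_uderive q x (kappa x) by move=> /Hk[].
have kappa_le x : Lam x -> enorm (kappa x) <= Kk by move=> /Hk[].
exists coef; rewrite /= (_ : vseq _ _ _ _ _ _ = orth_field); last first.
  by apply/funext => n; exact: vseq_coef.
split.
- split; first by move=> [//|n] x _ Lx; exact: orth_field_q.
  have [K K0 HK] := orth_field_geometric.
  apply: (geometric_cvg_uniformly_on _ K0 lam01); first by move=> u; exact: cauchy_cvg.
  (* Convergence is in the sup norm, which [enorm] dominates; the increment starts at index [n.+1],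
     and its extra factor [lam] is dropped. *)
  move=> n x Lx; apply: le_trans (norm_le_enorm _) _.
  apply: le_trans (HK n.+1 x Lx) _; apply: ler_wpM2l => //.
  by case/andP: lam01 => l0 l1; rewrite exprS ler_piMl ?exprn_ge0// ltW.
- split.
    move=> [//|n] _; apply: (uderive_unstable_differentiable (f' := d_coef kappa n.+1)) => x Lx.
    exact: is_uderive_coef.
  have [K K0 HK] := coef_geometric.
  apply: (geometric_cvg_uniformly_on _ K0 lam01); last exact: HK.
  by move=> u; exact: cauchy_cvg.
- move=> dv0_bounded.
  have [K K0 HK] := d_coef_geometric Kk0 q_kappa kappa_le dv0_bounded.
  apply: (geometric_cvg_uniformly_on _ K0 lam01); first by move=> u; exact: cauchy_cvg.
  move=> n x Lx; rewrite (is_uderive_derive Lx (is_uderive_coef (n := n.+1) q_kappa Lx)).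
  by rewrite (is_uderive_derive Lx (is_uderive_coef (n := n) q_kappa Lx)); exact: HK.
Qed.

End Decomposition.

End Parameterization.

End Dynamics.

Theorem theorem4p1 (R : realType) (m : nat)
  (M Lam : set 'rV[R]_m) (phi phiV : 'rV[R]_m -> 'rV[R]_m)
  (Eu Es : 'rV[R]_m -> {vspace 'rV[R]_m}) (q : 'rV[R]_m -> 'rV[R]_m)
  (eps : 'rV[R]_m -> R) (Phi : 'rV[R]_m -> R -> 'rV[R]_m)
  (chi : 'rV[R]_m -> 'rV[R]_m) :
  open M ->
  diffeo 3 M phi phiV ->
  hyperbolic_attractor M phi phiV Lam Eu Es ->
  unstable_unit_field phi phiV Lam Eu q ->
  unstable_parameterization M phiV Lam q eps Phi ->
  (forall x, M x -> differentiable chi x) ->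
  bounded_field M chi ->
  bounded_differential M chi ->
  forall v0 : 'rV[R]_m -> 'rV[R]_m,
  bounded_field Lam v0 ->
  unstable_differentiable Lam eps Phi v0 ->
  exists a : nat -> 'rV[R]_m -> R,
    let v := vseq phi phiV q chi a v0 in
    [/\ (forall n x, (1 <= n)%N -> Lam x -> dot (v n x) (q x) = 0) /\
        cvg_uniformly_on Lam v,
        (forall n, (1 <= n)%N -> unstable_differentiable Lam eps Phi (a n)) /\
        cvg_uniformly_on Lam a &
        bounded_field Lam (unstable_derive Phi v0) ->
        cvg_uniformly_on Lam (fun n => unstable_derive Phi (a n))].
Proof.
move=> oM dM [cLam LamM phiLam _ [C [lam [C0 lam01 hyp]]]] uq par dchi bchi bdchi v0 bv0 dv0.
exact: (orthogonal_decomposition oM dM cLam LamM phiLam C0 lam01 hyp uq par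
  dchi bchi bdchi bv0 dv0).
Qed.
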